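(* Let $n\ge2$, $\mathfrak{a}=(a_1,\dots,a_n)\in\mathbb{R}_{>0}^n$, and $P_k=k-P\in\mathbb{C}[x_1^{\pm1},\dots,x_n^{\pm1}]$ for $k\in\mathbb{C}$, with $P$ having no constant term. For each $j$, let $v_j$ be the largest power of $x_j^{-1}$ in $P_k$ and write $x_j^{v_j}P_k$ as a polynomial in $x_j$ with coefficients in $\mathbb{C}[x_1^{\pm1},\dots,\widehat{x_j},\dots,x_n^{\pm1}]$; let $P^j_{F,k}$ be its leading coefficient and $P^j_{f,k}$ its constant coefficient (functions of $(x_1,\dots,\widehat{x_j},\dots,x_n)$). Let $\mathcal{K}_{\mathfrak{a}}=\{P(x_1,\dots,x_n):|x_i|=a_i\ \forall i\}$, let $k_0$ lie in a bounded connected component of $\mathbb{C}\setminus\mathcal{K}_{\mathfrak{a}}$, and let $V_{\mathfrak{a},k_0}$ be that component. Let $\nu^j_{\mathfrak{a},k}$ be the number of zeros (with multiplicity) of $x_j\mapsto P_k(a_1,\dots,a_{j-1},x_j,a_{j+1},\dots,a_n)$ in $0<|x_j|<a_j$ minus the order of its pole at $x_j=0$. Fix $j\in\{1,\dots,n\}$. (I) If all roots of $x_j\mapsto P_{k_0}(a_1,\dots,a_{j-1},x_j,a_{j+1},\dots,a_n)$ lie inside the circle $|x_j|=a_j$, then for all $k\in V_{\mathfrak{a},k_0}$, $\mathrm{m}_{\mathfrak{a}}(P_k)=\nu^j_{\mathfrak{a},k}\log a_j+\mathrm{m}_{a_1,\dots,\widehat{a_j},\dots,a_n}(P^j_{F,k})$.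 (II) If all these roots lie outside the circle $|x_j|=a_j$, then for all $k\in V_{\mathfrak{a},k_0}$, $\mathrm{m}_{\mathfrak{a}}(P_k)=\nu^j_{\mathfrak{a},k}\log a_j+\mathrm{m}_{a_1,\dots,\widehat{a_j},\dots,a_n}(P^j_{f,k})$.
   Context: For nonzero $F\in\mathbb{C}(x_1,\dots,x_m)$ and $\mathfrak{b}\in\mathbb{R}_{>0}^m$, $\mathrm{m}_{\mathfrak{b}}(F)=\frac{1}{(2\pi i)^m}\int_{|x_i|=b_i\ \forall i}\log|F|\frac{dx_1}{x_1}\cdots\frac{dx_m}{x_m}$. The hat $\widehat{\ }$ denotes omission of the entry.
   Formalization: In (I) it is also assumed that x_j^{v_j}P_{k_0} at the a_i keeps its full generic degree in x_j (no root at infinity); in (II) 0 must not be a root of that polynomial; the pole order at 0 is negative when 0 is a zero. The claim fails without these. *)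

(* Defs.v *)
From HB Require Import structures.
From mathcomp Require Import all_boot all_order all_algebra.
From mathcomp Require Import finmap.
From mathcomp Require Import complex.
From mathcomp Require Import all_classical all_reals all_analysis.

Set Implicit Arguments.
Unset Strict Implicit.
Unset Printing Implicit Defensive.

Import Order.TTheory GRing.Theory Num.Theory.
Import numFieldNormedType.Exports.

Local Open Scope classical_set_scope.
Local Open Scope ring_scope.
Local Open Scope fset_scope.
Local Open Scope complex_scope.

(* R[i] carries the topology of its norm; [normc z : R] is the modulus. *)
Notation normc := ComplexField.Normc.normc.

Section Laurent.
Context {R : realType}.
Implicit Types n : nat.

(* The Laurent polynomial with coefficient [F m] at the monomial
   \prod_i x_i ^ (m i). *)
Definition laurent n := {fsfun {ffun 'I_n -> int} -> R[i] with 0}.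

(* Meaningful when all [x i] are nonzero. *)
Definition leval n (F : laurent n) (x : 'I_n -> R[i]) : R[i] :=
  \sum_(m <- finsupp F) F m * \prod_(i < n) x i ^ m i.

(* The Laurent polynomial k - P. *)
Definition const_sub n (k : R[i]) (P : laurent n) : laurent n :=
  [fsfun m in 0 |` finsupp P => (if m == 0 then k else 0) - P m].

Definition omit T n (j : 'I_n) (x : 'I_n -> T) : 'I_n.-1 -> T :=
  fun i => x (lift j i).

Definition insert_exp n (j : 'I_n) (e : int) (m : {ffun 'I_n.-1 -> int}) :
    {ffun 'I_n -> int} :=
  [ffun i => if unlift j i is Some i' then m i' else e].

Definition omit_exp n (j : 'I_n) (m : {ffun 'I_n -> int}) :
    {ffun 'I_n.-1 -> int} :=
  [ffun i => m (lift j i)].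

(* The coefficient of x_j ^ e in F. *)
Definition coefX n (j : 'I_n) (e : int) (F : laurent n) : laurent n.-1 :=
  [fsfun m' in [fset omit_exp j m | m in finsupp F] => F (insert_exp j e m')].

(* The largest powers of x_j^-1 and of x_j occurring in F, the power 0 being
   always allowed.  On [const_sub k P] these do not depend on k, so that vX + uX
   is the degree in x_j of x_j ^ v_j * (k - P) for generic k. *)
Definition vX n (j : 'I_n) (F : laurent n) : nat :=
  \max_(m <- finsupp F) absz (Num.min (m j) 0)%R.

Definition uX n (j : 'I_n) (F : laurent n) : nat :=
  \max_(m <- finsupp F) absz (Num.max (m j) 0)%R.

(* The degree in x_j of the polynomial x_j ^ v_j * F, with v_j = vX j F. *)
Definition degX n (j : 'I_n) (F : laurent n) : nat :=
  \max_(m <- finsupp F) absz (m j + (vX j F)%:Z)%R.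

(* The leading and the constant coefficient in x_j of x_j ^ v_j * F. *)
Definition leadX n (j : 'I_n) (F : laurent n) : laurent n.-1 :=
  coefX j ((degX j F)%:Z - (vX j F)%:Z) F.

Definition constX n (j : 'I_n) (F : laurent n) : laurent n.-1 :=
  coefX j (- (vX j F)%:Z) F.

(* x_j ^ v_j * F as a polynomial in x_j, the other variables being set to the
   a_i (the entry a_j is not used).  Its size is (vX + uX).+1 exactly when all
   vX + uX roots are finite, i.e. none has moved to infinity because the
   coefficient of x_j ^ uX vanishes at the a_i. *)
Definition specX n (j : 'I_n) (F : laurent n) (a : 'I_n -> R) : {poly R[i]} :=
  \poly_(e < (degX j F).+1)
    leval (coefX j (e%:Z - (vX j F)%:Z) F) (omit j (fun i => (a i)%:C)).

(* The roots of q, repeated according to multiplicity (for q != 0). *)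
Definition croots (q : {poly R[i]}) : seq R[i] :=
  sval (closed_field_poly_normal q).

(* Zeros of F(a_1, .., x_j, .., a_n) in 0 < |x_j| < a_j, minus the order of its
   pole at 0.  That order is v_j minus the multiplicity of 0 as a root of
   [specX j F a]; it is negative when F(a_1, .., x_j, .., a_n) vanishes at 0. *)
Definition nuX n (j : 'I_n) (F : laurent n) (a : 'I_n -> R) : int :=
  let q := specX j F a in
  (count (fun z => 0 < normc z < a j) (croots q))%:Z
  - ((vX j F)%:Z - (mup 0 q)%:Z).

Definition torus n (a : 'I_n -> R) : set ('I_n -> R[i]) :=
  [set x | forall i, normc (x i) = a i].

End Laurent.
Arguments laurent : clear implicits.

Section Mahler.
Context {R : realType}.

Local Notation T := (measurableTypeR R).

Definition cons_pair m (p : T * m.-tuple T) : m.+1.-tuple T :=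
  [the m.+1.-tuple T of p.1 :: p.2].

Lemma measurable_cons_pair m : measurable_fun setT (@cons_pair m).
Proof.
by apply: measurable_cons; [exact: measurable_fst|exact: measurable_snd].
Qed.

HB.instance Definition _ m := isMeasurableFun.Build _ _ _ _ (@cons_pair m)
  (@measurable_cons_pair m).

(* The product of m copies of the uniform probability measure on [0, 1]. *)
Fixpoint unit_cube m : probability (m.-tuple T) R :=
  if m is m'.+1 then
    distribution (uniform_prob (@ltr01 R) \x unit_cube m')%E (@cons_pair m')
  else dirac [tuple].

(* With x_i = b_i e^(2 pi i t_i) one has dx_i / (2 pi i x_i) = dt_i.  The value
   ln 0 = 0 of the library only matters where F vanishes. *)
Definition mahler m (b : 'I_m -> R) (F : ('I_m -> R[i]) -> R[i]) : \bar R :=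
  (\int[unit_cube m]_t
    (ln (normc (F (fun i => (b i)%:C *
       (cos (2 * pi * tnth t i) +i* sin (2 * pi * tnth t i))))))%:E)%E.

End Mahler.

(* Main.v *)
(* For a polynomial p without zeros of modulus r, Jensen's formula gives the
   circular mean of ln |p| as ln |lead_coef p| + sum of ln (max r |z|) over the
   roots z; it follows from the case of degree one, where doubling the angle
   squares the root and the radius. Comparing two nearby radii, the number of
   zeros in |z| < r is a continuous, hence locally constant, function of p.

   Write x_j ^ v_j * (k - P) as a polynomial in x_j. While k stays off K_a and the
   other coordinates stay on their circles, it has no zero on |x_j| = a_j, so its
   number of zeros inside is constant for k in the component V and the other
   coordinates on the torus. In case (I) this number is the full degree, in case
   (II) it is 0, and Jensen's formula reduces the mean over x_j to the leading,
   respectively constant, coefficient; Tonelli's theorem concludes. *)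
Require Import Defs.
From mathcomp Require Import all_boot all_order all_algebra.
From mathcomp Require Import finmap.
From mathcomp Require Import complex.
From mathcomp Require Import all_classical all_reals all_analysis.
From mathcomp Require Import measurable_realfun.
From mathcomp Require Import ring lra zify.

Set Implicit Arguments.
Unset Strict Implicit.
Unset Printing Implicit Defensive.

Import Order.TTheory GRing.Theory Num.Theory.
Import numFieldNormedType.Exports.

Local Open Scope classical_set_scope.
Local Open Scope ring_scope.
Local Open Scope complex_scope.

(** * Complex moduli and means over the unit circle *)

Section ComplexModulus.
Context {R : realType}.
Implicit Types z w : R[i].

Lemma normc_ge0 z : 0 <= normc z.
Proof. by case: z => x y; exact: sqrtr_ge0. Qed.

Lemma normc_gt0 z : (0 < normc z) = (z != 0).
Proof.
rewrite lt_def normc_ge0 andbT; congr (~~ _); apply/eqP/eqP => [|->].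
  exact: ComplexField.Normc.eq0_normc.
exact: ComplexField.Normc.normc0.
Qed.

Lemma normcX z n : normc (z ^+ n) = normc z ^+ n.
Proof.
elim: n => [|n IH]; first by rewrite !expr0 ComplexField.Normc.normc1.
by rewrite !exprS ComplexField.Normc.normcM IH.
Qed.

Lemma normc_real (x : R) : normc x%:C = `|x|.
Proof. by rewrite /= expr0n addr0 sqrtr_sqr. Qed.

Lemma normc_prod I (r : seq I) (Q : pred I) (F : I -> R[i]) :
  normc (\prod_(i <- r | Q i) F i) = \prod_(i <- r | Q i) normc (F i).
Proof.
by apply: (big_morph (@ComplexField.Normc.normc R));
  [exact: ComplexField.Normc.normcM|exact: ComplexField.Normc.normc1].
Qed.

Lemma le_normc_sum I (r : seq I) (Q : pred I) (F : I -> R[i]) :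
  normc (\sum_(i <- r | Q i) F i) <= \sum_(i <- r | Q i) normc (F i).
Proof.
elim/big_rec2: _ => [|i y x _ IH]; first by rewrite ComplexField.Normc.normc0.
by apply: le_trans (le_normcD _ _) _; rewrite lerD2l.
Qed.

Lemma normcB z w : normc (z - w) = normc (w - z).
Proof. by rewrite -normcN opprB. Qed.

Lemma ler_normcB z w : `|normc z - normc w| <= normc (z - w).
Proof.
rewrite ler_norml; apply/andP; split.
  by rewrite lerNl opprB lerBlDr normcB -{1}(subrK z w) le_normcD.
by rewrite lerBlDr -{1}(subrK w z) le_normcD.
Qed.

End ComplexModulus.

Section UnitCircle.
Context {R : realType}.
Implicit Types s t : R.

(** The point e^(2 pi i s), spelled as in the integrand of [mahler], so that [mahlerE] holds by
    computation. *)
Definition cis s : R[i] := cos (2 * pi * s) +i* sin (2 * pi * s).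

Lemma cisD s t : cis (s + t) = cis s * cis t.
Proof.
rewrite /cis mulrDr cosD sinD; apply/eqP; rewrite eq_complex /= eqxx /=.
by apply/eqP; ring.
Qed.

Lemma normc_cis s : normc (cis s) = 1.
Proof. by rewrite /= cos2Dsin2 sqrtr1. Qed.

Lemma cis0 : cis 0 = 1.
Proof. by rewrite /cis mulr0 cos0 sin0. Qed.

Lemma cis_half : cis 2^-1 = -1.
Proof.
rewrite /cis mulrAC divff ?pnatr_eq0// mul1r cospi sinpi.
by apply/eqP; rewrite eq_complex /= oppr0 !eqxx.
Qed.

Lemma cis_neq0 s : cis s != 0.
Proof. by rewrite -normc_gt0 normc_cis ltr01. Qed.

Lemma cisV s : (cis s)^-1 = cis (- s).
Proof.
by apply: (mulfI (cis_neq0 s)); rewrite mulfV ?cis_neq0// -cisD subrr cis0.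
Qed.

End UnitCircle.

Section MeanOverPeriod.
Context {R : realType}.
Notation mu := (@lebesgue_measure R).
Implicit Types f g : R -> R.

Definition mean f : R := (\int[mu]_(x in `[0%R, 1%R]) f x)%R.

Lemma continuous_integrable_itv f (a b : R) : continuous f ->
  mu.-integrable `[a, b] (EFin \o f).
Proof.
move=> cf; apply: continuous_compact_integrable; first exact: segment_compact.
by apply: continuous_subspaceT => x; exact: cf.
Qed.

Hint Extern 0 (measurable _) => solve [exact: measurable_itv] : core.

Lemma meanD f g : continuous f -> continuous g ->
  mean (fun x => f x + g x) = mean f + mean g.
Proof.
by move=> cf cg; rewrite /mean RintegralD//; exact: continuous_integrable_itv.
Qed.

Lemma meanZ (c : R) f : continuous f -> mean (fun x => c * f x) = c * mean f.
Proof.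
by move=> cf; rewrite /mean RintegralZl//; exact: continuous_integrable_itv.
Qed.

Lemma mean_cst (c : R) : mean (fun=> c) = c.
Proof.
rewrite /mean Rintegral_cst//= lebesgue_measure_itv/= lte_fin ltr01.
by rewrite -EFinB/= subr0 mulr1.
Qed.

Lemma le_mean f g : continuous f -> continuous g -> (forall x, f x <= g x) ->
  mean f <= mean g.
Proof.
move=> cf cg fg; apply: le_Rintegral => //; exact: continuous_integrable_itv.
Qed.

Lemma mean_ext f g : (forall x, f x = g x) -> mean f = mean g.
Proof. by move=> fg; congr mean; apply/funext. Qed.

Lemma Rintegral_affine f (c d : R) : 0 < d -> continuous f ->
  (\int[mu]_(x in `[c, c + d]) f x)%R = d * mean (fun s => f (c + d * s)).
Proof.
move=> d0 cf; rewrite -meanZ; last first.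
  move=> x; apply: (@continuous_comp _ _ _ (fun s => c + d * s) f).
    by apply: continuousD; [exact: cst_continuous|exact: mulrl_continuous].
  exact: cf.
have dF : (fun s : R => c + d * s)^`()%classic = fun=> d.
  by apply/funext => x; rewrite derive1E derive_val add0r mul1r; exact: mulr1.
rewrite /mean /Rintegral; congr fine.
have := @integration_by_substitution_increasing R (fun s => c + d * s) f 0 1.
rewrite mulr0 addr0 mulr1 => ->//.
- by apply: eq_integral => x _; rewrite dF /= mulrC.
- by move=> x y _ _ xy; rewrite ltrD2l ltr_pM2l.
- by rewrite dF => x _; exact: cst_continuous.
- by rewrite dF; exact: is_cvg_cst.
- by rewrite dF; exact: is_cvg_cst.
- split => [x _||]; first exact: ex_derive.
  + apply: cvg_at_right_filter.
    by apply: continuousD; [exact: cst_continuous|exact: mulrl_continuous].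
  + apply: cvg_at_left_filter.
    by apply: continuousD; [exact: cst_continuous|exact: mulrl_continuous].
- by apply: continuous_subspaceT => x; exact: cf.
Qed.

(** Each half of the unit interval is rescaled to the whole by an affine substitution; s/2 and s/2 +
    1/2 are the two preimages of the angle s under doubling. *)
Lemma mean_halves f : continuous f ->
  mean f = 2^-1 * (mean (fun s => f (2^-1 * s)) + mean (fun s => f (2^-1 * s + 2^-1))).
Proof.
move=> cf; rewrite mulrDr.
have h0 : (0 : R) < 2^-1 by rewrite invr_gt0.
have := Rintegral_affine 0 h0 cf; rewrite add0r => E1.
have := Rintegral_affine 2^-1 h0 cf.
rewrite (_ : 2^-1 + 2^-1 = 1 :> R); last by lra.
have -> : mean (fun s => f (2^-1 * s)) = mean (fun s => f (0 + 2^-1 * s)).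
  by apply: mean_ext => s; rewrite add0r.
have -> : mean (fun s => f (2^-1 * s + 2^-1)) = mean (fun s => f (2^-1 + 2^-1 * s)).
  by apply: mean_ext => s; rewrite addrC.
rewrite -E1 => <-; rewrite /mean.
have := @Rintegral_itvB R f (BLeft 0) (BRight 1) (2^-1).
move=> /(_ (continuous_integrable_itv 0 1 cf)).
rewrite !bnd_simp => H.
rewrite -(@Rintegral_itv_obnd_cbnd R 2^-1 (BRight 1) f); last first.
  apply: integrableS (continuous_integrable_itv 0 1 cf) => //.
  by apply: subset_itv; rewrite bnd_simp// ltW.
by rewrite -H ?subrKC//; lra.
Qed.

End MeanOverPeriod.

(** * Regularity of complex functions through their real and imaginary parts *)

Section RealAndImaginaryParts.
Context {R : realType} {X : Type}.

(** Abstracts the closure properties shared by continuity in one angle and measurability on the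
    cube, so that each argument on Laurent polynomials is made once. *)
Definition real_algebra (Q : (X -> R) -> Prop) :=
  [/\ forall c, Q (fun=> c),
      forall f g, Q f -> Q g -> Q (fun x => f x + g x) &
      forall f g, Q f -> Q g -> Q (fun x => f x * g x)].

Definition both_parts (Q : (X -> R) -> Prop) (g : X -> R[i]) :=
  Q (fun x => complex.Re (g x)) /\ Q (fun x => complex.Im (g x)).

Variable Q : (X -> R) -> Prop.
Hypothesis QA : real_algebra Q.

Lemma both_parts_cst c : both_parts Q (fun=> c).
Proof. by case: QA => Qc _ _; split; exact: Qc. Qed.

Lemma both_parts_add f g :
  both_parts Q f -> both_parts Q g -> both_parts Q (fun x => f x + g x).
Proof.
case: QA => _ QD _ [f1 f2] [g1 g2].
by split; [move: (QD _ _ f1 g1)|move: (QD _ _ f2 g2)];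
  congr Q; apply/funext => x; case: (f x); case: (g x).
Qed.

Lemma both_parts_mul f g :
  both_parts Q f -> both_parts Q g -> both_parts Q (fun x => f x * g x).
Proof.
case: QA => Qc QD QM [f1 f2] [g1 g2]; split.
  move: (QD _ _ (QM _ _ f1 g1) (QM _ _ (Qc (-1)) (QM _ _ f2 g2))).
  congr Q; apply/funext => x; case: (f x) => a b; case: (g x) => c d /=.
  by rewrite mulN1r.
move: (QD _ _ (QM _ _ f1 g2) (QM _ _ f2 g1)).
by congr Q; apply/funext => x; case: (f x) => a b; case: (g x) => c d /=.
Qed.

Lemma both_parts_sum I (r : seq I) (F : I -> X -> R[i]) :
  (forall i, both_parts Q (F i)) -> both_parts Q (fun x => \sum_(i <- r) F i x).
Proof.
move=> QF; elim: r => [|i r IH].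
  rewrite (_ : (fun _ => _) = fun=> 0); first exact: both_parts_cst.
  by apply/funext => x; rewrite big_nil.
rewrite (_ : (fun _ => _) = fun x => F i x + \sum_(i <- r) F i x).
  exact: both_parts_add.
by apply/funext => x; rewrite big_cons.
Qed.

Lemma both_parts_prod I (r : seq I) (F : I -> X -> R[i]) :
  (forall i, both_parts Q (F i)) -> both_parts Q (fun x => \prod_(i <- r) F i x).
Proof.
move=> QF; elim: r => [|i r IH].
  rewrite (_ : (fun _ => _) = fun=> 1); first exact: both_parts_cst.
  by apply/funext => x; rewrite big_nil.
rewrite (_ : (fun _ => _) = fun x => F i x * \prod_(i <- r) F i x).
  exact: both_parts_mul.
by apply/funext => x; rewrite big_cons.
Qed.

Lemma both_parts_exp f n : both_parts Q f -> both_parts Q (fun x => f x ^+ n).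
Proof.
move=> Qf; elim: n => [|n IH]; first exact: both_parts_cst.
rewrite (_ : (fun _ => _) = fun x => f x * f x ^+ n); first exact: both_parts_mul.
by apply/funext => x; rewrite exprS.
Qed.

Lemma normc_ReIm (z : R[i]) :
  normc z = Num.sqrt (complex.Re z * complex.Re z + complex.Im z * complex.Im z).
Proof. by case: z => a b /=; rewrite -!expr2. Qed.

Lemma both_parts_normc_sqr f : both_parts Q f ->
  Q (fun x => complex.Re (f x) * complex.Re (f x) + complex.Im (f x) * complex.Im (f x)).
Proof. by case: QA => _ QD QM [f1 f2]; apply: QD; apply: QM. Qed.

End RealAndImaginaryParts.

(** * The circular mean of the logarithm of a linear polynomial *)

Section MeanOfLogarithm.
Context {R : realType}.
Implicit Types (al be z w : R[i]) (p q : {poly R[i]}).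

Lemma continuous_real_algebra : @real_algebra R R (fun f => continuous f).
Proof.
split => [c x|f g cf cg x|f g cf cg x]; first exact: cst_continuous.
  by apply: continuousD; [exact: cf|exact: cg].
by apply: (@continuousM R R f g x); [exact: cf|exact: cg].
Qed.

Let cA := continuous_real_algebra.

(** The factor [t] serves the homotopy that scales all angles of a torus point by [s]. *)
Lemma both_parts_cis_scale (t : R) :
  both_parts (fun f : R -> R => continuous f) (fun s => cis (s * t)).
Proof.
have ch : continuous (fun s : R => 2 * pi * (s * t)).
  move=> x; apply: (@continuousM R R (fun=> 2 * pi) (fun s => s * t) x).
    exact: cst_continuous.
  exact: mulrr_continuous.
split => x /=; apply: (@continuous_comp R R R (fun s => 2 * pi * (s * t)) _ x (ch x)).
- exact: continuous_cos.
- exact: continuous_sin.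
Qed.

Lemma both_parts_cis : both_parts (fun f : R -> R => continuous f) cis.
Proof.
have := both_parts_cis_scale 1.
by congr both_parts; apply/funext => s; rewrite mulr1.
Qed.

Lemma continuous_normc (f : R -> R[i]) :
  both_parts (fun f : R -> R => continuous f) f ->
  continuous (fun s => normc (f s)).
Proof.
move=> cf s; rewrite (_ : (fun _ => _) = Num.sqrt \o
    (fun x => complex.Re (f x) * complex.Re (f x) + complex.Im (f x) * complex.Im (f x))).
  apply: continuous_comp; first exact: (both_parts_normc_sqr cA cf).
  exact: sqrt_continuous.
by apply/funext => x /=; rewrite normc_ReIm.
Qed.

Lemma continuous_ln_normc (f : R -> R[i]) :
  both_parts (fun f : R -> R => continuous f) f -> (forall s, f s != 0) ->
  continuous (fun s => ln (normc (f s))).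
Proof.
move=> cf f0 s.
apply: (@continuous_comp _ _ _ (fun s => normc (f s)) (@ln R)).
  exact: continuous_normc.
by apply: continuous_ln; rewrite normc_gt0.
Qed.

Lemma linear_cis_neq0 al be s : normc al != normc be -> al * cis s - be != 0.
Proof.
apply: contraNneq => /eqP; rewrite subr_eq0 => /eqP <-.
by rewrite ComplexField.Normc.normcM normc_cis mulr1.
Qed.

Lemma continuous_ln_linear al be : normc al != normc be ->
  continuous (fun s => ln (normc (al * cis s - be))).
Proof.
move=> ne; apply: continuous_ln_normc; last by move=> s; exact: linear_cis_neq0.
apply: both_parts_add => //; last exact: both_parts_cst.
by apply: both_parts_mul => //; [exact: both_parts_cst|exact: both_parts_cis].
Qed.

(* The two preimages of a point under doubling of the angle contribute
   (al w - be) (- al w - be) = be ^ 2 - al ^ 2 w ^ 2. *)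
Lemma mean_ln_linear_sqr al be : normc al != normc be ->
  mean (fun s => ln (normc (al * cis s - be))) =
  2^-1 * mean (fun s => ln (normc (al ^+ 2 * cis s - be ^+ 2))).
Proof.
move=> ne; rewrite mean_halves; last exact: continuous_ln_linear.
have cs (h : R -> R) (c : R) : continuous h ->
    continuous (fun s : R => h (2^-1 * s + c)).
  move=> ch x; apply: (@continuous_comp R R R (fun s => 2^-1 * s + c) h).
    by apply: continuousD; [exact: mulrl_continuous|exact: cst_continuous].
  exact: ch.
rewrite -meanD.
- congr (_ * _); apply: mean_ext => s.
  rewrite -lnM ?posrE ?normc_gt0 ?linear_cis_neq0//.
  rewrite -ComplexField.Normc.normcM cisD cis_half -normcN.
  have -> : cis s = cis (2^-1 * s) * cis (2^-1 * s) by rewrite -cisD; congr cis; lra.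
  by congr (ln (normc _)); ring.
- rewrite (_ : (fun s => ln _) =
      (fun s => ln (normc (al * cis (2^-1 * s + 0) - be)))).
    exact: cs (continuous_ln_linear ne).
  by apply/funext => s; rewrite addr0.
- exact: cs (continuous_ln_linear ne).
Qed.

(** Induction on [n]. At the start, M - m <= |al w - be| <= M + m on the unit circle. Squaring [al]
    and [be] doubles both the mean and ln M, so each squaring halves the deviation, while the factor
    ln M - ln (M - m) less than doubles and the slack suffices. *)
Lemma mean_ln_linear_dist (n : nat) (M m : R) al be : 0 <= m -> m < M ->
  (normc al = M /\ normc be = m) \/ (normc al = m /\ normc be = M) ->
  `|mean (fun s => ln (normc (al * cis s - be))) - ln M|
    <= 2^-1 ^+ n * (ln M - ln (M - m)).
Proof.
elim: n M m al be => [|n IH] M m al be m0 mM ab.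
  have ne : normc al != normc be.
    by case: ab => -[-> ->]; rewrite ?(gt_eqF mM)// (lt_eqF mM).
  have M0 : 0 < M by exact: le_lt_trans mM.
  have Mm0 : 0 < M - m by rewrite subr_gt0.
  have cl := continuous_ln_linear ne.
  have cc (c : R) : continuous (fun _ : R => c) by move=> x; exact: cst_continuous.
  have bd s : M - m <= normc (al * cis s - be) <= M + m.
    have E : normc (al * cis s) = normc al.
      by rewrite ComplexField.Normc.normcM normc_cis mulr1.
    have H1 := le_normcD (al * cis s) (- be); rewrite normcN E in H1.
    have := ler_normcB (al * cis s) be; rewrite E ler_norml => /andP[H2 H3].
    by case: ab H1 H2 H3 => -[-> ->] *; lra.
  rewrite expr0 mul1r ler_norml; apply/andP; split.
    rewrite opprB lerBrDr subrK -[leLHS]mean_cst; apply: le_mean => // s.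
    by rewrite ler_ln ?posrE//; [case/andP: (bd s)|case/andP: (bd s) => /(lt_le_trans Mm0)].
  rewrite lerBlDr -[leRHS]mean_cst; apply: le_mean => // s.
  have Mp0 : 0 < M + m by lra.
  apply: (@le_trans _ _ (ln (M + m))).
    by rewrite ler_ln ?posrE//; [case/andP: (bd s)|case/andP: (bd s) => /(lt_le_trans Mm0)].
  (* The upper deviation is at most the lower one because (M + m) (M - m) <= M ^ 2. *)
  rewrite addrAC lerBrDr -!lnM ?posrE// ler_ln ?posrE ?mulr_gt0//.
  by rewrite -[leRHS]expr2 mulrC -subr_sqr lerBlDr lerDl sqr_ge0.
have ne : normc al != normc be.
  by case: ab => -[-> ->]; rewrite ?(gt_eqF mM)// (lt_eqF mM).
have M0 : 0 < M by exact: le_lt_trans mM.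
have mM2 : m ^+ 2 < M ^+ 2 by rewrite ltrXn2r// ltW.
have := IH (M ^+ 2) (m ^+ 2) (al ^+ 2) (be ^+ 2) (sqr_ge0 _) mM2.
rewrite !normcX => /(_ (ltac:(by case: ab => -[-> ->]; [left|right]))) H.
have l2 : ln (M ^+ 2) = 2 * ln M by rewrite lnXn// mulr_natl.
rewrite mean_ln_linear_sqr//.
rewrite (_ : _ - ln M = 2^-1 * (mean (fun s : R => ln (normc (al ^+ 2 * cis s - be ^+ 2)))
  - ln (M ^+ 2))); last by rewrite l2; field.
rewrite normrM gtr0_norm ?invr_gt0// [2^-1 ^+ n.+1]exprS -mulrA ler_pM2l ?invr_gt0//.
apply: le_trans H _; rewrite ler_pM2l ?exprn_gt0 ?invr_gt0//.
(* With M ^ 2 - m ^ 2 factored, the squared bound is 2 ln M - ln (M - m) - ln (M + m), which ln M <=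
   ln (M + m) brings below the original one. *)
rewrite l2 subr_sqr lnM ?posrE; [|lra|lra].
have : ln M <= ln (M + m) by rewrite ler_ln ?posrE; lra.
by move=> ?; lra.
Qed.

Lemma le0_of_halving (x B : R) : (forall n, x <= 2^-1 ^+ n * B) -> x <= 0.
Proof.
move=> H; rewrite leNgt; apply/negP => x0.
have B0 : 0 < B by have := H 0%N; rewrite expr0 mul1r; exact: lt_le_trans.
(* For this [n], B < n x <= 2 ^ n x, which contradicts the hypothesis at [n]. *)
pose n := Num.bound (B / x).
have Bn : B < n%:R * x.
  by rewrite -ltr_pdivrMr// archi_boundP// divr_ge0// ltW.
have := H n; rewrite exprVn ler_pdivlMl ?exprn_gt0// => H1.
have : n%:R * x <= 2 ^+ n * x by rewrite ler_pM2r// -natrX ler_nat ltnW// ltn_expl.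
by lra.
Qed.

(** Jensen's formula in degree one: the deviation from ln M is below arbitrarily small multiples of
    a fixed number. *)
Lemma mean_ln_linear al be : normc al != normc be ->
  mean (fun s => ln (normc (al * cis s - be))) = ln (Num.max (normc al) (normc be)).
Proof.
move=> ne; apply/eqP; rewrite -subr_eq0 -normr_le0.
pose M := Num.max (normc al) (normc be); pose m := Num.min (normc al) (normc be).
apply: (@le0_of_halving _ (ln M - ln (M - m))) => n.
apply: mean_ln_linear_dist; rewrite /M /m; case: (ltgtP (normc al) (normc be)) ne => // h _.
- exact: normc_ge0.
- exact: normc_ge0.
- by right.
- by left.
Qed.

End MeanOfLogarithm.

(** * Jensen's formula and the stability of root counts *)

Section JensenFormula.
Context {R : realType}.
Implicit Types (z w : R[i]) (p q : {poly R[i]}).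

Lemma crootsE p : p = lead_coef p *: \prod_(z <- croots p) ('X - z%:P).
Proof. by rewrite /croots; case: (closed_field_poly_normal p). Qed.

Lemma mem_croots p z : p != 0 -> (z \in croots p) = root p z.
Proof.
move=> p0; rewrite [in RHS](crootsE p) rootZ ?lead_coef_eq0//.
by rewrite root_prod_XsubC.
Qed.

Lemma size_croots p : p != 0 -> size p = (size (croots p)).+1.
Proof.
move=> p0; rewrite [in LHS](crootsE p) size_scale ?lead_coef_eq0//.
by rewrite size_prod_XsubC.
Qed.

Lemma mup_croots p z : p != 0 -> mup z p = count_mem z (croots p).
Proof.
move=> p0; rewrite [in LHS](crootsE p) -mul_polyC.
rewrite mupMr ?rootC ?lead_coef_eq0//.
elim: (croots p) => [|w zs IH]; first by rewrite big_nil mupNroot ?root1.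
rewrite big_cons mupM ?polyXsubC_eq0 ?monic_neq0 ?monic_prod_XsubC// IH.
by rewrite -['X - w%:P]expr1 mup_XsubCX /=; case: eqP.
Qed.

Lemma normc_horner p z :
  normc p.[z] = normc (lead_coef p) * \prod_(w <- croots p) normc (z - w).
Proof.
rewrite {1}(crootsE p) hornerZ horner_prod ComplexField.Normc.normcM normc_prod.
by congr (_ * _); apply: eq_bigr => w _; rewrite hornerXsubC.
Qed.

Lemma both_parts_horner p r :
  both_parts (fun f : R -> R => continuous f) (fun s => p.[r * cis s]).
Proof.
have cA := @continuous_real_algebra R.
elim/poly_ind: p => [|p c IH].
  rewrite (_ : (fun _ => _) = fun=> 0); first exact: both_parts_cst.
  by apply/funext => s; rewrite horner0.
rewrite (_ : (fun _ => _) = fun s => p.[r * cis s] * (r * cis s) + c).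
  apply: both_parts_add => //; last exact: both_parts_cst.
  apply: both_parts_mul => //; apply: both_parts_mul => //.
    exact: both_parts_cst.
  exact: both_parts_cis.
by apply/funext => s; rewrite hornerMXaddC.
Qed.

Definition log_mean p (r : R) := mean (fun s => ln (normc p.[r%:C * cis s])).

Lemma normc_circle (r s : R) : 0 < r -> normc (r%:C * cis s) = r.
Proof.
by move=> r0; rewrite ComplexField.Normc.normcM normc_cis mulr1 normc_real gtr0_norm.
Qed.

Section Circle.
Variables (p : {poly R[i]}) (r : R).
Hypotheses (r0 : 0 < r) (p0 : p != 0).
Hypothesis rootp : forall z, root p z -> normc z != r.

Lemma horner_circle_neq0 s : p.[r%:C * cis s] != 0.
Proof.
apply: contraPneq (@rootp (r%:C * cis s)) => /rootP pz /(_ pz).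
by rewrite normc_circle ?eqxx.
Qed.

Lemma continuous_ln_horner_circle :
  continuous (fun s => ln (normc p.[r%:C * cis s])).
Proof.
apply: continuous_ln_normc; first exact: both_parts_horner.
exact: horner_circle_neq0.
Qed.

(** The polynomial splits into linear factors, the logarithm turns the product into a sum, and each
    factor is an instance of [mean_ln_linear] with [al] equal to the radius. *)
Lemma jensen_formula :
  log_mean p r =
  ln (normc (lead_coef p)) + \sum_(z <- croots p) ln (Num.max r (normc z)).
Proof.
have rz z : z \in croots p -> normc r%:C != normc z.
  rewrite mem_croots// => /rootp; rewrite normc_real gtr0_norm// eq_sym.
  exact.
transitivity (mean (fun s => ln (normc (lead_coef p)) +
    \sum_(z <- croots p) ln (normc (r%:C * cis s - z)))).
  apply: mean_ext => s.
  have ph : all (fun z => 0 < normc (r%:C * cis s - z)) (croots p).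
    apply/allP => z zp; rewrite normc_gt0 subr_eq0.
    by apply: contraNneq (rz _ zp) => <-; rewrite normc_circle// normc_real gtr0_norm.
  rewrite normc_horner.
  have c0 : 0 < normc (lead_coef p) by rewrite normc_gt0 lead_coef_eq0.
  have [_ {1}->] : 0 < \prod_(w <- croots p) normc (r%:C * cis s - w) /\
    ln (normc (lead_coef p) * \prod_(w <- croots p) normc (r%:C * cis s - w)) =
      ln (normc (lead_coef p)) + \sum_(w <- croots p) ln (normc (r%:C * cis s - w)).
    elim: (croots p) ph => [|z zs IH] /=.
      by rewrite !big_nil mulr1 addr0 ltr01.
    move=> /andP[hz /IH [h1 h2]]; rewrite !big_cons; split.
      by rewrite mulr_gt0.
    by rewrite mulrCA lnM ?posrE ?mulr_gt0// h2 addrCA.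
  by [].
(* Continuity is carried along in the induction because [meanD] requires it at each step. *)
have H : forall zs : seq R[i], (forall z, z \in zs -> normc r%:C != normc z) ->
  continuous (fun s => \sum_(z <- zs) ln (normc (r%:C * cis s - z))) /\
  mean (fun s => \sum_(z <- zs) ln (normc (r%:C * cis s - z))) =
    \sum_(z <- zs) ln (Num.max r (normc z)).
  elim=> [|z zs IH] h.
    rewrite big_nil; split.
      rewrite (_ : (fun _ => _) = fun=> 0); last by apply/funext => s; rewrite big_nil.
      by move=> s; exact: cst_continuous.
    by rewrite -[RHS](@mean_cst R); apply: mean_ext => s; rewrite big_nil.
  have [c1 e1] : _ /\ _ := IH (fun z' h' => h z' (mem_behead (s := z :: zs) h')).
  have c2 := continuous_ln_linear (h z (mem_head _ _)).
  have -> : (fun s => \sum_(z0 <- z :: zs) ln (normc (r%:C * cis s - z0))) =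
    (fun s => ln (normc (r%:C * cis s - z)) +
       \sum_(z0 <- zs) ln (normc (r%:C * cis s - z0))).
    by apply/funext => s; rewrite big_cons.
  split.
    move=> s; apply: (@continuousD R R R (fun s => ln (normc (r%:C * cis s - z)))
      (fun s => \sum_(z0 <- zs) ln (normc (r%:C * cis s - z0)))).
      exact: c2.
    exact: c1.
  rewrite meanD// e1 big_cons mean_ln_linear ?normc_real ?gtr0_norm//.
  by have := h z (mem_head _ _); rewrite normc_real gtr0_norm.
have [c1 e1] := H _ rz.
by rewrite meanD// ?mean_cst ?e1// => s; exact: cst_continuous.
Qed.

End Circle.

Definition nroots_disc p (r : R) := count (fun z => normc z < r) (croots p).

(** The bound 2 r keeps the outer circle in the disc where [nroots_disc_stable] controls the
    perturbation. *)
Lemma exists_free_annulus (s : seq R) (r : R) : 0 < r -> r \notin s ->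
  exists2 r', r < r' < 2 * r & all (fun x => ~~ (r <= x <= r')) s.
Proof.
move=> r0; elim: s => [|x s IH].
  by move=> _; exists (3 / 2 * r) => //; apply/andP; split; lra.
rewrite inE negb_or => /andP[rx /IH [r' /andP[h1 h2] h3]].
case: (ltgtP r x) rx => // hx _.
(* The midpoint of r and x excludes the new element x > r. *)
- exists (Num.min r' ((r + x) / 2)).
    by rewrite lt_min gt_min h1 h2 /= andbT; lra.
  apply/andP; split.
    rewrite le_min !negb_and -!ltNge.
    have -> : (r + x) / 2 < x by lra.
    by rewrite !orbT.
  apply/allP => y ys; apply: contra (allP h3 _ ys).
  by rewrite le_min => /and3P[-> -> _].
- by exists r'; rewrite /= ?h1 ?h2// h3 andbT; lra.
Qed.

(** In Jensen's formula a root inside the smaller circle contributes ln r' - ln r to the difference,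
    and a root beyond the larger one contributes nothing. *)
Lemma log_mean_annulus p (r r' : R) : 0 < r -> r < r' -> p != 0 ->
  (forall z, root p z -> ~~ (r <= normc z <= r')) ->
  log_mean p r' - log_mean p r = (ln r' - ln r) *+ nroots_disc p r.
Proof.
move=> r0 rr' p0 H.
have r'0 : 0 < r' by lra.
rewrite !jensen_formula//; last 2 first.
- by move=> z /H; apply: contraNneq => ->; rewrite lexx ltW.
- by move=> z /H; apply: contraNneq => ->; rewrite lexx ltW.
rewrite opprD addrACA subrr add0r -sumrB /nroots_disc -sum1_count -sumrMnr.
rewrite [RHS]big_mkcond /= big_seq [RHS]big_seq; apply: eq_bigr => z; rewrite mem_croots// => /H.
rewrite negb_and -!ltNge => /orP[h|h].
  by rewrite h !max_l// ?ltW//; lra.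
rewrite [_ < r]ltNge ltW ?(lt_trans rr')//= !max_r ?subrr// ltW//.
exact: lt_trans h.
Qed.

(** Follows from ln (1 + t) <= t applied to the quotient of the two arguments. *)
Lemma ln_dist (x y d : R) : 0 < d -> d <= x -> d <= y ->
  `|ln x - ln y| <= `|x - y| / d.
Proof.
move=> d0.
have H u v : d <= u -> u <= v -> ln v - ln u <= (v - u) / d.
  move=> du uv; have u0 : 0 < u by exact: lt_le_trans du.
  have v0 : 0 < v by exact: lt_le_trans uv.
  rewrite -ln_div ?posrE//.
  rewrite (_ : v / u = 1 + (v - u) / u); last by field; rewrite gt_eqF.
  apply: le_trans (le_ln1Dx _) _.
    by apply: (@lt_le_trans _ _ 0) => //; rewrite divr_ge0 ?subr_ge0// ltW.
  by rewrite ler_wpM2l ?subr_ge0// lef_pV2 ?posrE.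
move=> dx dy; case: (leP x y) => xy.
  rewrite distrC (distrC x) !ger0_norm ?subr_ge0 ?H//.
  by rewrite ler_ln ?posrE//; exact: lt_le_trans d0 _.
rewrite !ger0_norm ?subr_ge0 ?(ltW xy)// ?H// ?ltW//.
by rewrite ltr_ln ?posrE//; exact: lt_le_trans d0 _.
Qed.

Lemma log_mean_dist p q (r d e : R) : 0 < r -> 0 < d ->
  (forall z, normc z = r -> d <= normc p.[z]) ->
  (forall z, normc z = r -> d <= normc q.[z]) ->
  (forall z, normc z = r -> normc (q.[z] - p.[z]) <= e) ->
  `|log_mean q r - log_mean p r| <= e / d.
Proof.
move=> r0 d0 hp hq hpq.
have cf (f : {poly R[i]}) : (forall z, normc z = r -> d <= normc f.[z]) ->
    continuous (fun s => ln (normc f.[r%:C * cis s])).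
  move=> h; apply: continuous_ln_horner_circle => // z /rootP fz.
  apply/eqP => /h; rewrite fz ComplexField.Normc.normc0.
  by rewrite leNgt d0.
have cp := cf _ hp; have cq := cf _ hq.
have bd s : `|ln (normc q.[r%:C * cis s]) - ln (normc p.[r%:C * cis s])| <= e / d.
  have zr := normc_circle s r0.
  apply: le_trans (ln_dist d0 (hq _ zr) (hp _ zr)) _.
  apply: ler_wpM2r; first by rewrite invr_ge0 ltW.
  exact: le_trans (ler_normcB _ _) (hpq _ zr).
have cc (c : R) : continuous (fun _ : R => c) by move=> x; exact: cst_continuous.
have cD (f : R -> R) (c : R) : continuous f -> continuous (fun s => f s + c).
  by move=> cff s; apply: continuousD; [exact: cff|exact: cc].
rewrite ler_norml; apply/andP; split.
  rewrite lerBrDr addrC -[in leLHS](mean_cst (- (e / d))) -meanD//.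
  apply: le_mean => //; first exact: cD.
  by move=> s; have := bd s; rewrite ler_norml => /andP[h1 h2]; lra.
rewrite lerBlDr addrC -[in leRHS](mean_cst (e / d)) -meanD//.
apply: le_mean => //; first exact: cD.
by move=> s; have := bd s; rewrite ler_norml => /andP[h1 h2]; lra.
Qed.

Lemma natr_dist_lt1 (a b : nat) : `|a%:R - b%:R : R| < 1 -> a = b.
Proof.
wlog ab : a b / (a <= b)%N => [H|].
  by case/orP: (leq_total a b) => ab h; [|symmetry]; apply: H => //; rewrite distrC.
rewrite distrC -natrB// normr_nat ltrn1 ltnS leqn0 subn_eq0 => ba.
by apply/eqP; rewrite eqn_leq ab.
Qed.

(* Jensen's formula on two nearby circles of radii r < r' without zeros between
   them recovers the number of zeros in the smaller disc as
   (log_mean r' - log_mean r) / (ln r' - ln r), which is continuous in p. *)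
Lemma nroots_disc_stable p (r : R) : 0 < r -> p != 0 ->
  (forall z, root p z -> normc z != r) ->
  exists2 e : R, 0 < e & forall q,
    (forall z, normc z <= 2 * r -> normc (q.[z] - p.[z]) <= e) ->
    nroots_disc q r = nroots_disc p r.
Proof.
move=> r0 p0 pr.
have [||r' /andP[rr' r'2] fr] := @exists_free_annulus [seq normc z | z <- croots p] r.
- by [].
- by apply/mapP => -[z]; rewrite mem_croots// => /pr /eqP h1 h2; exact: h1.
have r'0 : 0 < r' by lra.
have fr' z : root p z -> ~~ (r <= normc z <= r').
  by rewrite -mem_croots// => zp; have /allP := fr; apply; exact: (map_f (fun z => normc z)).
(* The distance from |w| to the interval [r, r']; the product [d] below therefore bounds |p| from
   below on the closed annulus. *)
pose dist w := Num.max (r - normc w) (normc w - r').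
have dist0 w : root p w -> 0 < dist w.
  by move=> /fr'; rewrite negb_and -!ltNge lt_max !subr_gt0.
pose d := normc (lead_coef p) * \prod_(w <- croots p) dist w.
have d0 : 0 < d.
  rewrite mulr_gt0// ?normc_gt0 ?lead_coef_eq0//.
  by rewrite big_seq prodr_gt0// => w; rewrite mem_croots//; exact: dist0.
have dp z : r <= normc z <= r' -> d <= normc p.[z].
  move=> /andP[z1 z2]; rewrite normc_horner ler_wpM2l ?normc_ge0//.
  rewrite big_seq [leRHS]big_seq; apply: ler_prod => w; rewrite mem_croots// => pw.
  rewrite ltW ?dist0//= ge_max.
  have := ler_normcB z w; rewrite ler_norml => /andP[h1 h2].
  by apply/andP; split; lra.
have lnrr' : 0 < ln r' - ln r by rewrite subr_gt0 ltr_ln ?posrE.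
(* The first bound keeps |q| >= d / 2 on the annulus. The second moves each of the two means by at
   most a quarter of ln r' - ln r. *)
pose e := Num.min (d / 2) (d * (ln r' - ln r) / 8).
have e0 : 0 < e by rewrite lt_min !divr_gt0// mulr_gt0.
exists e => // q pq.
have dq z : r <= normc z <= r' -> d / 2 <= normc q.[z].
  move=> zr; have := dp _ zr.
  have /pq : normc z <= 2 * r by case/andP: zr => _ /le_trans; apply; exact: ltW.
  rewrite le_min => /andP[h1 _] h2.
  have := ler_normcB q.[z] p.[z]; rewrite ler_norml => /andP[h3 h4]; lra.
have q0 : q != 0.
  apply/eqP => q00; have := dq r%:C.
  rewrite q00 horner0 ComplexField.Normc.normc0 normc_real gtr0_norm// lexx (ltW rr').
  by move=> /(_ isT); lra.
have qr z : root q z -> ~~ (r <= normc z <= r').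
  move=> /rootP qz; apply/negP => /dq; rewrite qz ComplexField.Normc.normc0.
  by rewrite leNgt divr_gt0.
have close x : r <= x <= r' -> `|log_mean q x - log_mean p x| <= e / (d / 2).
  move=> /andP[rx xr]; apply: log_mean_dist.
  - exact: lt_le_trans rx.
  - by rewrite divr_gt0.
  - move=> z zx; apply: le_trans (dp z _); last by rewrite zx rx.
    by lra.
  - by move=> z zx; apply: dq; rewrite zx rx.
  - by move=> z zx; apply: pq; rewrite zx; lra.
have e1 := close r; have e2 := close r'.
rewrite lexx (ltW rr') in e1; rewrite lexx (ltW rr') in e2.
have {}e1 := e1 isT; have {}e2 := e2 isT.
have eb : e / (d / 2) <= (ln r' - ln r) / 4.
  rewrite ler_pdivrMr ?divr_gt0//; have : e <= d * (ln r' - ln r) / 8.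
    by rewrite ge_min lexx orbT.
  by move/le_trans; apply; lra.
have E1 := log_mean_annulus r0 rr' p0 fr'.
have E2 := log_mean_annulus r0 rr' q0 qr.
(* Multiplied by ln r' - ln r, the difference of the two counts is at most half of that number, so
   the counts differ by less than 1. *)
apply: natr_dist_lt1.
rewrite -(ltr_pM2l lnrr') mulr1 -[X in X * _](gtr0_norm lnrr') -normrM mulrBr !mulr_natr.
rewrite -E1 -E2 [X in `|X|](_ : _ = (log_mean q r' - log_mean p r')
  - (log_mean q r - log_mean p r)); last by ring.
apply: le_lt_trans (ler_normB _ _) _.
apply: le_lt_trans (lerD (le_trans e2 eb) (le_trans e1 eb)) _.
by move: lnrr'; clear; lra.
Qed.

End JensenFormula.

(** * Integration over the unit cube, one coordinate at a time *)

Section UnitCube.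
Context {R : realType}.
Notation mu := (@lebesgue_measure R).
Local Notation T := (measurableTypeR R).
Local Notation U := (uniform_prob (@ltr01 R)).
Local Open Scope ereal_scope.

Definition insert_coord m (j : 'I_m.+1) (s : T) (t : m.-tuple T) : m.+1.-tuple T :=
  [tuple if unlift j i is Some i' then tnth t i' else s | i < m.+1].

Lemma tnth_insert_coord m (j : 'I_m.+1) s t : tnth (insert_coord j s t) j = s.
Proof. by rewrite tnth_mktuple unlift_none. Qed.

Lemma tnth_insert_coord_lift m (j : 'I_m.+1) s t i :
  tnth (insert_coord j s t) (lift j i) = tnth t i.
Proof. by rewrite tnth_mktuple liftK. Qed.

Lemma insert_coord0 m s (t : m.-tuple T) : insert_coord ord0 s t = cons_pair (s, t).
Proof.
apply: eq_from_tnth => i; case: (unliftP ord0 i) => [i'|] ->.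
  by rewrite tnth_insert_coord_lift /cons_pair tnthS.
by rewrite tnth_insert_coord.
Qed.

(** Lets the induction on the dimension pass below the first coordinate, the one that [unit_cube]
    splits off. *)
Lemma insert_coordS m (j : 'I_m.+1) r s (t : m.-tuple T) :
  insert_coord (lift ord0 j) r (cons_pair (s, t)) = cons_pair (s, insert_coord j r t).
Proof.
apply: eq_from_tnth => i; case: (unliftP (lift ord0 j) i) => [i'|] ->; last first.
  by rewrite tnth_insert_coord /cons_pair tnthS tnth_insert_coord.
rewrite tnth_insert_coord_lift; case: (unliftP ord0 i') => [i''|] ->.
  have -> : lift (lift ord0 j) (lift ord0 i'') = lift ord0 (lift j i'').
    by apply: val_inj; rewrite /= /bump /=; lia.
  by rewrite /cons_pair !tnthS tnth_insert_coord_lift.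
have -> : lift (lift ord0 j) (ord0 : 'I_m.+1) = ord0 by apply: val_inj.
by [].
Qed.

Lemma measurable_insert_coord m (j : 'I_m.+1) :
  measurable_fun setT (fun p => insert_coord j p.1 p.2).
Proof.
apply/measurable_fun_tnthP => i /=; case: (unliftP j i) => [i'|] ->.
  rewrite (_ : _ \o _ = (fun t : m.-tuple T => tnth t i') \o snd).
    by apply: measurableT_comp => //; exact: measurable_tnth.
  by apply/funext => p /=; rewrite tnth_insert_coord_lift.
rewrite (_ : _ \o _ = fst) //.
by apply/funext => p /=; rewrite tnth_insert_coord.
Qed.

Lemma integral_unit_cubeS m (f : m.+1.-tuple T -> \bar R) :
  measurable_fun setT f -> (forall t, 0 <= f t) ->
  \int[unit_cube m.+1]_t f t = \int[U \x unit_cube m]_p f (cons_pair p).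
Proof.
move=> mf f0; rewrite [unit_cube m.+1]/=.
exact: ge0_integral_distribution.
Qed.

(** For the first coordinate this is Tonelli's theorem. Otherwise the first coordinate is taken
    outside on both sides, and the induction hypothesis applies to the remaining ones. *)
Lemma integral_unit_cube_insert m (j : 'I_m.+1) (f : m.+1.-tuple T -> \bar R) :
  measurable_fun setT f -> (forall t, 0 <= f t) ->
  \int[unit_cube m.+1]_t f t =
  \int[unit_cube m]_t \int[U]_s f (insert_coord j s t).
Proof.
elim: m j f => [|m IH] j f mf f0.
  rewrite integral_unit_cubeS// fubini_tonelli2//; last first.
    by apply: measurableT_comp => //; exact: measurable_cons_pair.
  apply: eq_integral => t _; apply: eq_integral => s _ /=.
  by rewrite (ord1 j) insert_coord0.
have mfc : measurable_fun setT (f \o @cons_pair R m.+1).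
  by apply: measurableT_comp => //; exact: measurable_cons_pair.
case: (unliftP ord0 j) => [j'|] ->; last first.
  rewrite integral_unit_cubeS// fubini_tonelli2//.
  apply: eq_integral => t _; apply: eq_integral => s _ /=.
  by rewrite insert_coord0.
rewrite integral_unit_cubeS// (fubini_tonelli1 (fun p => f (cons_pair p)))//.
rewrite [RHS]integral_unit_cubeS//; last first.
- by move=> t; exact: integral_ge0.
- apply: (@measurable_fun_fubini_tonelli_G _ _ _ _ _ U
    (fun p => f (insert_coord (lift ord0 j') p.1 p.2))) => //.
  by apply: measurableT_comp => //; exact: measurable_insert_coord.
rewrite (@fubini_tonelli1 _ _ _ _ _ U (unit_cube m)
  (fun p => \int[U]_s f (insert_coord (lift ord0 j') s (cons_pair p))))//; last first.
- by move=> t; exact: integral_ge0.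
- apply: (@measurableT_comp _ _ _ _ _ _
    (fun t => \int[U]_s f (insert_coord (lift ord0 j') s t))); last first.
    exact: measurable_cons_pair.
  apply: (@measurable_fun_fubini_tonelli_G _ _ _ _ _ U
    (fun p => f (insert_coord (lift ord0 j') p.1 p.2))) => //.
  by apply: measurableT_comp => //; exact: measurable_insert_coord.
apply: eq_integral => s _; rewrite /fubini_F /=.
rewrite (IH j' (fun t => f (cons_pair (s, t))))//.
  by apply: eq_integral => t _; apply: eq_integral => r _; rewrite insert_coordS.
by apply: (measurableT_comp mfc); exact: measurable_pair1.
Qed.

(* No integrability is needed: both sides are -oo when the integral of h is +oo. *)
Lemma integral_cstB d (X : measurableType d) (Q : probability X R) (C : R)
    (h : X -> R) : measurable_fun setT h -> (forall x, (0 <= h x)%R) ->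
  \int[Q]_x (C - h x)%:E = C%:E - \int[Q]_x (h x)%:E.
Proof.
move=> mh h0.
have mEh : measurable_fun setT (EFin \o h) by exact/measurable_EFinP.
have mCh : measurable_fun setT (fun x => (C - h x)%:E).
  by apply/measurable_EFinP; apply: measurable_funB.
have ih0 : 0 <= \int[Q]_x (h x)%:E by apply: integral_ge0 => x _; rewrite lee_fin.
have iC (c : R) : Q.-integrable setT (cst c%:E) by exact: finite_measure_integrable_cst.
have iCE (c : R) : \int[Q]_x c%:E = c%:E.
  by rewrite integral_cst// [X in _ * X](@probability_setT _ _ _ Q) mule1.
case: (ltP (\int[Q]_x (h x)%:E) +oo) => [fin|].
  have ih : Q.-integrable setT (EFin \o h).
    apply/integrableP; split => //.
    rewrite (eq_integral (EFin \o h))// => x _.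
    by rewrite /= ger0_norm.
  have := integralB_EFin measurableT (iC C) ih; rewrite /= iCE => <-.
  by apply: eq_integral => x _; rewrite EFinB.
rewrite leye_eq => /eqP E; rewrite E /=.
rewrite integralE.
(* When the integral of [h] is infinite, h <= (C - h)^- + |C| makes that of the negative part
   infinite too, while the positive part stays below |C|. *)
have hneg : \int[Q]_x (fun x => (C - h x)%:E)^\- x = +oo.
  apply/eqP; rewrite -leye_eq.
  have : \int[Q]_x (h x)%:E <= \int[Q]_x ((fun x => (C - h x)%:E)^\- x + `|C|%:E).
    apply: ge0_le_integral => //.
    - by move=> x xT; rewrite lee_fin.
    - by apply: emeasurable_funD => //; exact: measurable_funeneg.
    - move=> x _; rewrite funenegE -EFinN -EFin_max -EFinD lee_fin.
      rewrite -lerBlDr le_max opprB lerB//; exact: ler_norm.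
  rewrite E ge0_integralD//; last exact: measurable_funeneg.
  rewrite iCE; case: (\int[Q]_x _) => //.
have hpos : \int[Q]_x (fun x => (C - h x)%:E)^\+ x <= `|C|%:E.
  rewrite -[leRHS]iCE; apply: ge0_le_integral => //.
  - exact: measurable_funepos.
  - move=> x _; rewrite funeposE -EFin_max lee_fin ge_max normr_ge0 andbT.
    by apply: le_trans (ler_norm C); rewrite lerBlDr lerDl.
rewrite hneg; move: hpos; case: (\int[Q]_x _) => //.
Qed.

Lemma integral_uniform01 (f : R -> R) (c : R) : continuous f -> (forall s, (0 <= f s)%R) ->
  mean f = c -> \int[U]_s (f s)%:E = c%:E.
Proof.
move=> cf f0 <-.
have mf : measurable_fun setT (fun s => (f s)%:E).
  by apply/measurable_EFinP; exact: continuous_measurable_fun.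
rewrite (integral_uniform _ mf); last by move=> s; rewrite lee_fin.
rewrite subr0 invr1 mul1e /mean /Rintegral fineK//.
exact: integrable_fin_num (continuous_integrable_itv _ _ cf).
Qed.

End UnitCube.

(** * Laurent polynomials as polynomials in one variable *)

Section LaurentSections.
Context {R : realType}.
Implicit Types (n : nat).

(** The support of k - P varies with k; a common larger index set allows sums to be compared. *)
Lemma leval_sub n (F : laurent R n) (S : {fset {ffun 'I_n -> int}}) x :
  (finsupp F `<=` S)%fset ->
  leval F x = \sum_(m <- S) F m * \prod_(i < n) x i ^ m i.
Proof.
move=> FS; rewrite /leval; apply: big_fset_incl => // m _ mF.
by rewrite fsfun_dflt// mul0r.
Qed.

Lemma const_subE n (k : R[i]) (P : laurent R n) m :
  const_sub k P m = (if m == 0 then k else 0) - P m.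
Proof.
rewrite /const_sub fsfunE; case: ifPn => // mS.
move: mS; rewrite !inE negb_or => /andP[/negbTE -> mP].
by rewrite fsfun_dflt// subr0.
Qed.

Lemma leval_const_sub n (k : R[i]) (P : laurent R n) x :
  leval (const_sub k P) x = k - leval P x.
Proof.
pose S : {fset {ffun 'I_n -> int}} := (0 |` finsupp P)%fset.
have zS : 0 \in S by rewrite !inE eqxx.
rewrite (@leval_sub _ P S) ?fsubsetUr// (@leval_sub _ _ S).
  under eq_bigr do rewrite const_subE mulrBl.
  rewrite big_split /= sumrN; congr (_ - _).
  rewrite (big_fsetD1 0)//= eqxx big1 ?mulr1 => [|i _]; last by rewrite ffunE.
  by rewrite big_seq big1 ?addr0// => m; rewrite !inE => /andP[/negbTE -> _]; rewrite mul0r.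
apply/fsubsetP => m; rewrite mem_finsupp const_subE !inE mem_finsupp.
by case: (m =P 0) => //= _; rewrite sub0r oppr_eq0.
Qed.

Section Coordinate.
Variables (n : nat) (j : 'I_n.+1).
Implicit Types (F P : laurent R n.+1).

Lemma omit_insert_exp e (m : {ffun 'I_n -> int}) :
  omit_exp j (insert_exp j e m) = m.
Proof. by apply/ffunP => i; rewrite !ffunE liftK. Qed.

Lemma insert_omit_exp (m : {ffun 'I_n.+1 -> int}) :
  insert_exp j (m j) (omit_exp j m) = m.
Proof.
by apply/ffunP => i; rewrite !ffunE; case: unliftP => [i'|] ->; rewrite ?ffunE.
Qed.

Lemma coefXE e F m : Defs.coefX j e F m = F (insert_exp j e m).
Proof.
rewrite /Defs.coefX fsfunE; case: ifPn => // mS; rewrite fsfun_dflt//.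
apply: contraNN mS => mF; apply/imfsetP; exists (insert_exp j e m) => //.
by rewrite omit_insert_exp.
Qed.

(** The constant k sits at the exponent 0, so it survives only in the coefficient of x_j ^ 0, again
    as a constant. *)
Lemma coefX_const_sub e (k : R[i]) P :
  Defs.coefX j e (const_sub k P) = const_sub (if e == 0 then k else 0) (Defs.coefX j e P).
Proof.
apply/fsfunP => m; rewrite coefXE !const_subE coefXE; congr (_ - _).
have [->|m0] := eqVneq m 0; have [->|e0] := eqVneq e 0.
- rewrite ifT//; apply/eqP/ffunP => i; rewrite !ffunE.
  by case: unliftP => [i'|] _; rewrite ?ffunE.
- rewrite ifF//; apply: contra_neqF e0 => /eqP /ffunP /(_ j).
  by rewrite !ffunE unlift_none.
- rewrite ifF//; apply: contra_neqF m0 => /eqP h.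
  by rewrite -(omit_insert_exp 0 m) h; apply/ffunP => i; rewrite !ffunE.
- rewrite ifF//; apply: contra_neqF m0 => /eqP h.
  by rewrite -(omit_insert_exp e m) h; apply/ffunP => i; rewrite !ffunE.
Qed.

Lemma leval_coefX e F y :
  leval (Defs.coefX j e F) y =
  \sum_(m <- finsupp F | m j == e) F m * \prod_(i < n) y i ^ m (lift j i).
Proof.
rewrite big_fset_condE /=; set A := [fset m in finsupp F | m j == e]%fset.
pose S := [fset omit_exp j m | m in A]%fset.
rewrite (@leval_sub _ _ S).
  rewrite big_imfset /=.
    apply: eq_big_seq => m; rewrite !inE => /andP[_ /eqP <-].
    rewrite coefXE insert_omit_exp; congr (_ * _).
    by apply: eq_bigr => i _; rewrite ffunE.
  (* Deleting the exponent of x_j is injective on monomials where that exponent is fixed. *)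
  move=> m m'; rewrite !inE => /andP[_ /eqP h] /andP[_ /eqP h'] hh.
  by rewrite -(insert_omit_exp m) -(insert_omit_exp m') h h' hh.
apply/fsubsetP => m; rewrite mem_finsupp coefXE => mF.
apply/imfsetP; exists (insert_exp j e m); last by rewrite omit_insert_exp.
by rewrite !inE mem_finsupp mF ffunE unlift_none eqxx.
Qed.

(* The polynomial x_j ^ v F in x_j, of formal degree d, at the point y of the
   other coordinates; v and d do not depend on the constant term of F. *)
Definition section_poly (v d : nat) F (y : 'I_n -> R[i]) : {poly R[i]} :=
  \poly_(e < d.+1) leval (Defs.coefX j (e%:Z - v%:Z) F) y.

Lemma horner_section_polyE (v d : nat) F y z :
  (section_poly v d F y).[z] =
  \sum_(e < d.+1) leval (Defs.coefX j (e%:Z - v%:Z) F) y * z ^+ e.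
Proof. exact: horner_poly. Qed.

Lemma le_normc_section_polyB (v d : nat) F y y' z :
  normc ((section_poly v d F y').[z] - (section_poly v d F y).[z]) <=
  \sum_(e < d.+1) normc (leval (Defs.coefX j (e%:Z - v%:Z) F) y' -
    leval (Defs.coefX j (e%:Z - v%:Z) F) y) * normc z ^+ e.
Proof.
rewrite !horner_section_polyE -sumrB.
apply: le_trans (le_normc_sum _ _ _) _; apply: ler_sum => e _.
by rewrite -mulrBl ComplexField.Normc.normcM normcX.
Qed.

(** Multiplication by x_j ^ v moves k to degree v, which v <= d keeps within the formal degree. *)
Lemma section_poly_const_sub (v d : nat) (k : R[i]) P y : (v <= d)%N ->
  section_poly v d (const_sub k P) y = k *: 'X^v - section_poly v d P y.
Proof.
move=> vd; apply/polyP => e; rewrite coefB coefZ coefXn !coef_poly.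
case: ltnP => ed; last first.
  by rewrite subr0 gtn_eqF ?mulr0// (leq_ltn_trans vd).
rewrite coefX_const_sub leval_const_sub subr_eq0 eqz_nat.
by case: eqP; rewrite ?mulr1 ?mulr0.
Qed.

Lemma horner_section_poly (v d : nat) F (x : 'I_n.+1 -> R[i]) :
  (forall m, m \in finsupp F -> 0 <= m j + v%:Z <= d%:Z) -> x j != 0 ->
  (section_poly v d F (omit j x)).[x j] = leval F x * x j ^+ v.
Proof.
move=> hF x0; rewrite horner_section_polyE [in RHS]/leval mulr_suml.
under eq_bigr do rewrite leval_coefX mulr_suml big_mkcond /=.
rewrite exchange_big /= big_seq [RHS]big_seq; apply: eq_bigr => m mF.
have /andP[h1 h2] := hF m mF.
have hd : (`|(m j + v%:Z)%R|%N < d.+1)%N by rewrite ltnS -lez_nat gez0_abs.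
(* After the exchange of sums, the monomial m contributes only in degree m_j + v. *)
rewrite (bigD1 (Ordinal hd)) //= gez0_abs// addrK eqxx [X in _ + X]big1 ?addr0.
  rewrite -!mulrA; congr (_ * _).
  rewrite (@bigD1_ord _ _ _ _ j)//=. rewrite mulrAC mulrC; congr (_ * _).
  by rewrite exprnP gez0_abs// expfzDr.
move=> e he; case: eqP => // hm; case/eqP: he; apply: val_inj => /=.
by rewrite hm subrK.
Qed.

Lemma finsupp_const_sub (k : R[i]) P (m : {ffun 'I_n.+1 -> int}) : m j != 0 ->
  (m \in finsupp (const_sub k P)) = (m \in finsupp P).
Proof.
move=> mj; rewrite !mem_finsupp const_subE ifF ?sub0r ?oppr_eq0//.
by apply: contra_neqF mj => /eqP ->; rewrite ffunE.
Qed.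

Lemma vX_const_sub (k : R[i]) P : vX j (const_sub k P) = vX j P.
Proof.
apply/eqP; rewrite eqn_leq; apply/andP; split; apply/bigmax_leqP_seq => m mF _.
  have [mj|mj] := eqVneq (m j) 0; first by rewrite mj minxx.
  by rewrite (leq_bigmax_seq
    (F := fun m : {ffun 'I_n.+1 -> int} => absz (Num.min (m j) 0)%R))// -(finsupp_const_sub k).
have [mj|mj] := eqVneq (m j) 0; first by rewrite mj minxx.
by rewrite (leq_bigmax_seq
    (F := fun m : {ffun 'I_n.+1 -> int} => absz (Num.min (m j) 0)%R))// finsupp_const_sub.
Qed.

Lemma uX_const_sub (k : R[i]) P : uX j (const_sub k P) = uX j P.
Proof.
apply/eqP; rewrite eqn_leq; apply/andP; split; apply/bigmax_leqP_seq => m mF _.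
  have [mj|mj] := eqVneq (m j) 0; first by rewrite mj maxxx.
  by rewrite (leq_bigmax_seq
    (F := fun m : {ffun 'I_n.+1 -> int} => absz (Num.max (m j) 0)%R))// -(finsupp_const_sub k).
have [mj|mj] := eqVneq (m j) 0; first by rewrite mj maxxx.
by rewrite (leq_bigmax_seq
    (F := fun m : {ffun 'I_n.+1 -> int} => absz (Num.max (m j) 0)%R))// finsupp_const_sub.
Qed.

Lemma finsupp_exp_bounds F (m : {ffun 'I_n.+1 -> int}) : m \in finsupp F ->
  0 <= m j + (vX j F)%:Z <= (vX j F + uX j F)%N%:Z.
Proof.
move=> mF.
have := leq_bigmax_seq (F := fun m : {ffun 'I_n.+1 -> int} => absz (Num.min (m j) 0)%R)
  (P := predT) m mF isT.
have := leq_bigmax_seq (F := fun m : {ffun 'I_n.+1 -> int} => absz (Num.max (m j) 0)%R)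
  (P := predT) m mF isT.
rewrite -/(vX j F) -/(uX j F) PoszD.
by case: (ltgtP (m j) 0) => [?|?|->] /=; lia.
Qed.

Lemma finsupp_exp_le_degX F (m : {ffun 'I_n.+1 -> int}) : m \in finsupp F ->
  m j + (vX j F)%:Z <= (degX j F)%:Z.
Proof.
move=> mF; have /andP[h _] := finsupp_exp_bounds mF.
rewrite -[X in X <= _]gez0_abs// lez_nat.
exact: (leq_bigmax_seq (F := fun m : {ffun 'I_n.+1 -> int} => absz (m j + (vX j F)%:Z)%R)).
Qed.

(** The inequality is strict when all exponents of x_j in a nonzero [F] are negative. *)
Lemma degX_le F : (degX j F <= vX j F + uX j F)%N.
Proof.
apply/bigmax_leqP_seq => m mF _; have /andP[h1 h2] := finsupp_exp_bounds mF.
by rewrite -lez_nat gez0_abs.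
Qed.

Lemma leval_coefX_gt_degX F e y : (degX j F < e)%N ->
  leval (Defs.coefX j (e%:Z - (vX j F)%:Z) F) y = 0.
Proof.
move=> he; rewrite leval_coefX big_seq_cond big1// => m /andP[mF /eqP mj].
by have := finsupp_exp_le_degX mF; rewrite mj subrK lez_nat leqNgt he.
Qed.

(** Replaces [degX], which may change with k, by a formal degree that does not; the added
    coefficients vanish. *)
Lemma specX_section_poly F (a : 'I_n.+1 -> R) :
  specX j F a = section_poly (vX j F) (vX j F + uX j F) F (omit j (fun i => (a i)%:C)).
Proof.
apply/polyP => e; rewrite !coef_poly !ltnS.
case: (leqP e (degX j F)) => [he|he]; first by rewrite (leq_trans he (degX_le F)).
by rewrite leval_coefX_gt_degX//; case: ifP.
Qed.

(** A coefficient that is nonzero at one point shows that the degree in x_j reaches its largest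
    possible value. *)
Lemma leadXE F y : leval (Defs.coefX j (uX j F)%:Z F) y != 0 ->
  leadX j F = Defs.coefX j (uX j F)%:Z F.
Proof.
move=> h; rewrite /leadX; congr Defs.coefX.
suff -> : degX j F = (vX j F + uX j F)%N by rewrite PoszD addrC addKr.
apply/eqP; rewrite eqn_leq degX_le leqNgt; apply: contraNN h => h.
by rewrite -(leval_coefX_gt_degX y h) PoszD addrC addKr.
Qed.

(** The multiplicity of 0 in the pole order restores the root that the punctured disc leaves out. *)
Lemma nuXE F (a : 'I_n.+1 -> R) : specX j F a != 0 -> 0 < a j ->
  nuX j F a = (nroots_disc (specX j F a) (a j))%:Z - (vX j F)%:Z.
Proof.
move=> q0 aj; rewrite /nuX mup_croots// /nroots_disc.
rewrite opprB addrA -PoszD; congr (_%:Z - _).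
rewrite -count_predUI [X in (_ + X)%N](_ : _ = 0%N) ?addn0.
  apply: eq_count => z /=; rewrite normc_gt0.
  have [->|z0] := eqVneq z 0; last by rewrite orbF.
  by rewrite ComplexField.Normc.normc0 aj.
apply/eqP; rewrite -leqn0 leqNgt -has_count; apply/hasPn => z zq /=.
by apply/andP => -[/andP[h _] /eqP z0]; move: h; rewrite z0 ComplexField.Normc.normc0 ltxx.
Qed.

End Coordinate.

Lemma normcXz (z : R[i]) (e : int) : normc (z ^ e) = normc z ^ e.
Proof.
case: e => e; first by rewrite -!exprnP normcX.
by rewrite !NegzE -!exprnN ComplexField.Normc.normcV normcX.
Qed.

Definition leval_bound n (F : laurent R n) (b : 'I_n -> R) : R :=
  \sum_(m <- finsupp F) normc (F m) * \prod_(i < n) b i ^ m i.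

Lemma le_normc_leval n (F : laurent R n) (b : 'I_n -> R) x :
  (forall i, normc (x i) = b i) -> normc (leval F x) <= leval_bound F b.
Proof.
move=> xb; apply: le_trans (le_normc_sum _ _ _) _; apply: ler_sum => m _.
rewrite ComplexField.Normc.normcM normc_prod.
by under eq_bigr do rewrite normcXz xb.
Qed.

Lemma both_parts_leval (X : Type) (Q : (X -> R) -> Prop) n (F : laurent R n)
    (b : 'I_n -> R) (th : 'I_n -> X -> R) : real_algebra Q ->
  (forall i, both_parts Q (fun t => cis (th i t))) ->
  both_parts Q (fun t => leval F (fun i => (b i)%:C * cis (th i t))).
Proof.
move=> QA Qth; apply: both_parts_sum => // m.
apply: both_parts_mul => //; first exact: both_parts_cst.
apply: both_parts_prod => // i.
(* Negative powers need no closure under division: the inverse of [cis] is [cis] at the opposite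
   angle. *)
have Qn : both_parts Q (fun t => cis (- th i t)).
  have [Qc _ QM] := QA; have [Q1 Q2] := Qth i; split.
    by move: Q1; congr Q; apply/funext => t /=; rewrite mulrN cosN.
  move: (QM _ _ (Qc (-1)) Q2).
  by congr Q; apply/funext => t /=; rewrite mulrN sinN mulN1r.
case: (m i) => e.
  by apply: both_parts_exp => //; apply: both_parts_mul => //; exact: both_parts_cst.
rewrite (_ : (fun _ => _) = fun t => ((b i)%:C^-1 * cis (- th i t)) ^+ e.+1).
  by apply: both_parts_exp => //; apply: both_parts_mul => //; exact: both_parts_cst.
by apply/funext => t; rewrite NegzE -exprnN -cisV -invfM exprVn.
Qed.

End LaurentSections.

(** * Elimination of one variable from a Mahler measure *)

(** The level set of [N x] is nonempty, relatively open and relatively closed in [V]. *)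
Lemma locally_constant_on_connected (X : topologicalType) (V : set X) (N : X -> nat) :
  connected V -> (forall x, V x -> \forall y \near x, N y = N x) ->
  forall x y, V x -> V y -> N x = N y.
Proof.
move=> cV locN x y Vx Vy.
suff E : V `&` [set z | N z = N x] = V by move: Vy; rewrite -E => -[_ /= ->].
apply: cV; first by exists x.
- exists (interior [set z | N z = N x]); first exact: open_interior.
  apply/seteqP; split => z [Vz hz]; split => //=; last exact: nbhs_singleton hz.
  by move: hz => /= <-; exact: locN.
- exists (~` interior [set z | N z <> N x]).
    exact/open_closedC/open_interior.
  apply/seteqP; split => z [Vz hz]; split => //=.
    by move=> /nbhs_singleton /=; rewrite hz.
  apply: contrapT => ne; apply: hz.
  by apply: filterS (locN z Vz) => w /= ->.
Qed.

Section MahlerMeasure.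
Context {R : realType}.
Local Notation T := (measurableTypeR R).

Definition torus_point n (a th : 'I_n -> R) : 'I_n -> R[i] :=
  fun i => (a i)%:C * cis (th i).

Lemma torus_torus_point n (a th : 'I_n -> R) :
  (forall i, 0 < a i) -> torus a (torus_point a th).
Proof. by move=> a0 i; exact: normc_circle. Qed.

Lemma measurable_real_algebra d (X : measurableType d) :
  @real_algebra R X (fun f => measurable_fun setT f).
Proof.
by split => [c|f g mf mg|f g mf mg]; [exact: measurable_cst|
  exact: measurable_funD|exact: measurable_funM].
Qed.

Lemma measurable_ln_normc d (X : measurableType d) (f : X -> R[i]) :
  both_parts (fun f : X -> R => measurable_fun setT f) f ->
  measurable_fun setT (fun x => ln (normc (f x))).
Proof.
move=> mf; apply: (measurableT_comp (@measurable_ln R)).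
rewrite (_ : (fun _ => _) = Num.sqrt \o
    (fun x => complex.Re (f x) * complex.Re (f x) + complex.Im (f x) * complex.Im (f x))).
  apply: measurableT_comp.
    by apply: continuous_measurable_fun; exact: sqrt_continuous.
  exact: (both_parts_normc_sqr (measurable_real_algebra X) mf).
by apply/funext => x /=; rewrite normc_ReIm.
Qed.

Lemma measurable_ln_leval n (F : laurent R n) (a : 'I_n -> R) :
  measurable_fun setT
    (fun t : n.-tuple T => ln (normc (leval F (torus_point a (tnth t))))).
Proof.
apply: measurable_ln_normc; apply: both_parts_leval => [|i].
  exact: measurable_real_algebra.
have mi : measurable_fun setT (fun t : n.-tuple T => 2 * pi * tnth t i).
  apply: measurable_funM; first exact: measurable_cst.
  exact: measurable_tnth.
split; (apply: measurableT_comp; last exact: mi); apply: continuous_measurable_fun.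
- exact: continuous_cos.
- exact: continuous_sin.
Qed.

Lemma mahlerE n (F : laurent R n) (a : 'I_n -> R) :
  mahler a (leval F) =
  (\int[unit_cube n]_t (ln (normc (leval F (torus_point a (tnth t)))))%:E)%E.
Proof. by []. Qed.

Section EliminateCoordinate.
Variables (n : nat) (j : 'I_n.+1) (a : 'I_n.+1 -> R).
Hypothesis a0 : forall i, 0 < a i.

Lemma omit_torus_point_insert s (t : n.-tuple T) :
  omit j (torus_point a (tnth (insert_coord j s t))) =
  torus_point (omit j a) (tnth t).
Proof.
by apply/funext => i; rewrite /omit /torus_point tnth_insert_coord_lift.
Qed.

Lemma continuous_ln_leval_insert (F : laurent R n.+1) (t : n.-tuple T) :
  (forall x, torus a x -> leval F x != 0) ->
  continuous (fun s : R =>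
    ln (normc (leval F (torus_point a (tnth (insert_coord j s t)))))).
Proof.
move=> F0; apply: continuous_ln_normc; last first.
  by move=> s; apply: F0; exact: torus_torus_point.
apply: both_parts_leval => [|i]; first exact: continuous_real_algebra.
case: (unliftP j i) => [i'|] ->.
  rewrite (_ : (fun _ => _) = fun=> cis (tnth t i')).
    by apply: both_parts_cst; exact: continuous_real_algebra.
  by apply/funext => s; rewrite tnth_insert_coord_lift.
rewrite (_ : (fun _ => _) = cis); first exact: both_parts_cis.
by apply/funext => s; rewrite tnth_insert_coord.
Qed.

(* Tonelli is applied to C - ln |F| >= 0, where C bounds ln |F| on the torus. *)
Lemma mahler_eliminate (F : laurent R n.+1) (G : laurent R n) (c : R) :
  (forall x, torus a x -> leval F x != 0) ->
  (forall t : n.-tuple T,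
    mean (fun s => ln (normc (leval F (torus_point a (tnth (insert_coord j s t))))))
      = c + ln (normc (leval G (torus_point (omit j a) (tnth t))))) ->
  mahler a (leval F) = (c%:E + mahler (omit j a) (leval G))%E.
Proof.
move=> F0 hG; rewrite !mahlerE.
pose f (t : n.+1.-tuple T) : R := ln (normc (leval F (torus_point a (tnth t)))).
pose g (t : n.-tuple T) : R := ln (normc (leval G (torus_point (omit j a) (tnth t)))).
have mf : measurable_fun setT f := measurable_ln_leval F a.
have mg : measurable_fun setT g := measurable_ln_leval G (omit j a).
(* The sum of the moduli of the monomials bounds |F| on the torus. *)
pose C := ln (leval_bound F a).
have fC t : 0 <= C - f t.
  have F1 : 0 < normc (leval F (torus_point a (tnth t))).
    by rewrite normc_gt0; apply: F0; exact: torus_torus_point.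
  have F2 := le_normc_leval F (torus_torus_point (tnth t) a0).
  by rewrite subr_ge0 ler_ln ?posrE//; exact: lt_le_trans F1 F2.
have inner t : (\int[uniform_prob (@ltr01 R)]_s (C - f (insert_coord j s t))%:E
    = (C - c - g t)%:E)%E.
  have cf := continuous_ln_leval_insert (t := t) F0.
  apply: integral_uniform01 => //.
    move=> s; apply: (@continuousB R R R (fun=> C) (fun s => f (insert_coord j s t)) s).
      exact: cst_continuous.
    exact: cf.
  transitivity (mean (fun s => C + -1 * f (insert_coord j s t))).
    by apply: mean_ext => s; rewrite mulN1r.
  rewrite meanD; last 2 first.
  - by move=> s; exact: cst_continuous.
  - move=> s.
    apply: (@continuousM R R (fun=> -1) (fun s => f (insert_coord j s t)) s).
      exact: cst_continuous.
    exact: cf.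
  by rewrite mean_cst meanZ// hG mulN1r opprD addrA.
have gC t : 0 <= C - c - g t.
  rewrite -lee_fin -inner; apply: integral_ge0 => s _; rewrite lee_fin.
  exact: fC.
have E1 : (\int[unit_cube n.+1]_t (f t)%:E =
    C%:E - \int[unit_cube n.+1]_t (C - f t)%:E)%E.
  rewrite -integral_cstB//; last by apply: measurable_funB.
  by apply: eq_integral => t _; rewrite subKr.
have E2 : (\int[unit_cube n]_t (g t)%:E =
    (C - c)%:E - \int[unit_cube n]_t (C - c - g t)%:E)%E.
  rewrite -integral_cstB//; last by apply: measurable_funB.
  by apply: eq_integral => t _; rewrite subKr.
have E3 : (\int[unit_cube n.+1]_t (C - f t)%:E =
    \int[unit_cube n]_t (C - c - g t)%:E)%E.
  rewrite (@integral_unit_cube_insert _ _ j (fun t => (C - f t)%:E)).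
  - by apply: eq_integral => t _; rewrite inner.
  - by apply/measurable_EFinP; apply: measurable_funB.
  - by move=> t; rewrite lee_fin.
rewrite -/f -/g E1 E2 E3 EFinB.
have : (0 <= \int[unit_cube n]_t (C - c - g t)%:E)%E.
  by apply: integral_ge0 => t _; rewrite lee_fin.
(* If the integral is +oo, both sides equal -oo; otherwise the identity is between reals. *)
by case: (\int[unit_cube n]_t _)%E => //= x _; rewrite -!EFinB -EFinD; congr (_%:E); ring.
Qed.

End EliminateCoordinate.
End MahlerMeasure.

(** * Root counts along the torus *)

Section ExtremalRootCounts.
Context {R : realType}.
Variables (p : {poly R[i]}) (r : R).
Hypotheses (r0 : 0 < r) (p0 : p != 0).
Hypothesis rootp : forall z, root p z -> normc z != r.

(** With d roots and size at most d + 1, the degree is exactly d and all roots are inside, so each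
    Jensen term is ln r. *)
Lemma log_mean_roots_inside d : (size p <= d.+1)%N -> nroots_disc p r = d ->
  p`_d != 0 /\ log_mean p r = ln (normc p`_d) + d%:R * ln r.
Proof.
rewrite size_croots// ltnS => sd nd.
have sE : size (croots p) = d.
  by apply/eqP; rewrite eqn_leq sd -{1}nd count_size.
have lc : p`_d = lead_coef p by rewrite lead_coefE size_croots// sE.
rewrite lc lead_coef_eq0 p0; split => //.
rewrite jensen_formula//; congr (_ + _).
have /allP inside : all (fun z => normc z < r) (croots p).
  by rewrite all_count sE; apply/eqP.
rewrite (eq_big_seq (fun=> ln r)); last first.
  by move=> z /inside h; rewrite max_l// ltW.
by rewrite big_const_seq count_predT iter_addr_0 sE mulr_natl.
Qed.

(** Each Jensen term is ln |z|, and the leading coefficient times the product of the roots has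
    modulus |p(0)|. *)
Lemma log_mean_roots_outside : nroots_disc p r = 0%N ->
  p`_0 != 0 /\ log_mean p r = ln (normc p`_0).
Proof.
move=> n0.
have outside z : z \in croots p -> r <= normc z.
  move=> zp; rewrite leNgt; apply: contra_eqN n0 => zr.
  by rewrite /nroots_disc -lt0n -has_count; apply/hasP; exists z.
have -> : p`_0 = p.[0] by rewrite horner_coef0.
have np : normc p.[0] = normc (lead_coef p) * \prod_(w <- croots p) normc w.
  by rewrite normc_horner; under eq_bigr do rewrite sub0r normcN.
have c0 : 0 < normc (lead_coef p) by rewrite normc_gt0 lead_coef_eq0.
have [h1 h2] : 0 < \prod_(w <- croots p) normc w /\
    ln (\prod_(w <- croots p) normc w) = \sum_(w <- croots p) ln (normc w).
  elim: (croots p) outside => [|z zs IH] h; first by rewrite !big_nil ln1.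
  have [h1 h2] := IH (fun w wz => h w (mem_behead (s := z :: zs) wz)).
  have z0 : 0 < normc z := lt_le_trans r0 (h z (mem_head _ _)).
  by rewrite !big_cons mulr_gt0// lnM ?posrE// h2.
split; first by rewrite -normc_gt0 np mulr_gt0.
rewrite jensen_formula// np lnM ?posrE// h2; congr (_ + _).
by apply: eq_big_seq => z /outside h; rewrite max_r.
Qed.

End ExtremalRootCounts.

Section RootCountOnTorus.
Context {R : realType}.
Local Notation T := (measurableTypeR R).
Variables (n : nat) (j : 'I_n.+1) (a : 'I_n.+1 -> R).
Hypothesis a0 : forall i, 0 < a i.
Variable P : laurent R n.+1.

Let v := vX j P.
Let d := (vX j P + uX j P)%N.
Let K := [set leval P x | x in torus a].
Let q (k : R[i]) (y : 'I_n -> R[i]) := section_poly j v d (const_sub k P) y.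

Lemma leval_const_sub_neq0 k x : ~ K k -> torus a x -> leval (const_sub k P) x != 0.
Proof.
move=> kK xa; rewrite leval_const_sub subr_eq0; apply/eqP => kE.
by apply: kK; exists x.
Qed.

Lemma horner_section_const_sub k x : x j != 0 ->
  (q k (omit j x)).[x j] = leval (const_sub k P) x * x j ^+ v.
Proof.
move=> xj; apply: horner_section_poly => // m mP.
by have := finsupp_exp_bounds j mP; rewrite vX_const_sub uX_const_sub.
Qed.

(** With z as coordinate j the point stays on the torus, where k - P has no zero because k is not in
    K. *)
Lemma section_circle_neq0 k th z : ~ K k -> normc z = a j ->
  (q k (omit j (torus_point a th))).[z] != 0.
Proof.
move=> kK za; pose x i := if i == j then z else torus_point a th i.
have -> : omit j (torus_point a th) = omit j x.
  by apply/funext => i; rewrite /omit /x eq_sym (negbTE (neq_lift _ _)).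
have xj : x j = z by rewrite /x eqxx.
have z0 : z != 0 by rewrite -normc_gt0 za.
rewrite -xj horner_section_const_sub xj// mulf_neq0 ?expf_neq0//.
apply: leval_const_sub_neq0 => // i; rewrite /x.
by case: eqP => [->//|_]; exact: torus_torus_point.
Qed.

Lemma section_neq0 k th : ~ K k -> q k (omit j (torus_point a th)) != 0.
Proof.
move=> kK; have h : normc (a j)%:C = a j by rewrite normc_real gtr0_norm.
by apply: contraNneq (section_circle_neq0 th kK h) => ->; rewrite horner0.
Qed.

Lemma section_root k th z : ~ K k ->
  root (q k (omit j (torus_point a th))) z -> normc z != a j.
Proof.
by move=> kK /rootP qz; apply: contra_eqN qz => /eqP; exact: section_circle_neq0.
Qed.

Lemma nroots_section_near_k k th : ~ K k ->
  \forall k' \near (k : R[i]^o),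
    nroots_disc (q k' (omit j (torus_point a th))) (a j) =
    nroots_disc (q k (omit j (torus_point a th))) (a j).
Proof.
move=> kK.
have [e e0 He] := nroots_disc_stable (a0 j) (section_neq0 th kK)
  (fun z => @section_root k th z kK).
have r0 : 0 < (2 * a j) ^+ v by rewrite exprn_gt0// mulr_gt0.
(* The two sections differ by (k' - k) z ^ v, and |z| <= 2 a_j. *)
apply/nbhs_normP; exists (e / (2 * a j) ^+ v)%:C => /=.
  by rewrite ltcR divr_gt0.
move=> k'; rewrite /= normc_def -normc_ReIm => kk'.
apply: He => z zr; rewrite /q !section_poly_const_sub ?leq_addr//.
rewrite -hornerN -hornerD opprB addrA subrK -scalerBl hornerZ hornerXn.
rewrite ComplexField.Normc.normcM normcX normcB.
apply: le_trans (_ : normc (k - k') * (2 * a j) ^+ v <= e).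
  by rewrite ler_wpM2l ?normc_ge0// lerXn2r ?nnegrE ?normc_ge0// mulr_ge0// ltW.
by rewrite -ler_pdivlMr// ltW// -ltcR.
Qed.

Lemma nroots_section_near_angle k th (s : R) : ~ K k ->
  \forall s' \near s,
    nroots_disc (q k (omit j (torus_point a (fun i => s' * th i)))) (a j) =
    nroots_disc (q k (omit j (torus_point a (fun i => s * th i)))) (a j).
Proof.
move=> kK; pose y (s : R) := omit j (torus_point a (fun i => s * th i)).
have [e e0 He] := nroots_disc_stable (a0 j) (section_neq0 (fun i => s * th i) kK)
  (fun z => @section_root k (fun i => s * th i) z kK).
pose f (i : nat) s := leval (Defs.coefX j (i%:Z - v%:Z) P) (y s).
(* Bounds the change of the section on the disc of radius 2 a_j; it is continuous in s' and vanishes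
   at s. The terms in k cancel, so only coefficients of [P] enter. *)
pose g D s' := \sum_(i < D) normc (f i s' - f i s) * (2 * a j) ^+ i.
have cg D : continuous (g D).
  elim: D => [|D IH] x.
    rewrite (_ : g 0%N = fun=> 0); first exact: cst_continuous.
    by apply/funext => s'; rewrite /g big_ord0.
  rewrite (_ : g D.+1 =
    (fun s' => g D s' + normc (f D s' - f D s) * (2 * a j) ^+ D)); last first.
    by apply/funext => s'; rewrite /g big_ord_recr.
  apply: (@continuousD R R R (g D)
    (fun s' => normc (f D s' - f D s) * (2 * a j) ^+ D) x (IH x)).
  apply: (@continuousM R R (fun s' => normc (f D s' - f D s)) (fun=> _) x);
    last exact: cst_continuous.
  apply: continuous_normc; apply: both_parts_add.
  - exact: continuous_real_algebra.
  - apply: both_parts_leval; first exact: continuous_real_algebra.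
    by move=> i; exact: both_parts_cis_scale.
  - by apply: both_parts_cst; exact: continuous_real_algebra.
have gs : g d.+1 s = 0.
  by apply: big1 => i _; rewrite subrr ComplexField.Normc.normc0 mul0r.
have : \forall s' \near s, g d.+1 s' < e.
  by have := @cvgr_lt R R _ (nbhs_filter s) (g d.+1) _ (cg d.+1 s) e; rewrite gs; exact.
apply: filterS => s' gs'; apply: He => z zr; apply: le_trans (ltW gs').
rewrite /q !section_poly_const_sub ?leq_addr//.
rewrite -hornerN -hornerD.
have -> (A B C : {poly R[i]}) : A - B - (A - C) = C - B by ring.
rewrite hornerD hornerN normcB.
apply: le_trans (le_normc_section_polyB _ _ _ _ _ _ _) _; apply: ler_sum => i _.
apply: ler_wpM2l; first exact: normc_ge0.
by rewrite lerXn2r ?nnegrE ?normc_ge0// mulr_ge0// ltW.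
Qed.

(** Scaling the angles by s in [0, 1] joins the given torus point to the point with all angles 0. *)
Lemma nroots_section_angle k th : ~ K k ->
  nroots_disc (q k (omit j (torus_point a th))) (a j) =
  nroots_disc (q k (omit j (fun i => (a i)%:C))) (a j).
Proof.
move=> kK.
have := @locally_constant_on_connected R `[0, 1]
  (fun s => nroots_disc (q k (omit j (torus_point a (fun i => s * th i)))) (a j))
  (@segment_connected R 0 1)
  (fun s _ => @nroots_section_near_angle k th s kK) 1 0.
rewrite /= !in_itv /= lexx ler01 lexx => /(_ isT isT).
have -> : torus_point a (fun i => 1 * th i) = torus_point a th.
  by apply/funext => i; rewrite /torus_point mul1r.
have -> // : torus_point a (fun i => 0 * th i) = (fun i => (a i)%:C).
by apply/funext => i; rewrite /torus_point mul0r cis0 mulr1.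
Qed.

(** The angles are first moved to 0 with k0 fixed; then k varies in [V] with the angles fixed. *)
Lemma nroots_section_const k0 (V := connected_component (~` K : set R[i]^o) k0) k th :
  ~ K k0 -> V k ->
  ~ K k /\ nroots_disc (q k (omit j (torus_point a th))) (a j) =
    nroots_disc (specX j (const_sub k0 P) a) (a j).
Proof.
move=> k0K Vk; have VK : V `<=` ~` K by exact: connected_component_sub.
split; first exact: VK.
have specE : specX j (const_sub k0 P) a = q k0 (omit j (fun i => (a i)%:C)).
  by rewrite specX_section_poly vX_const_sub uX_const_sub.
rewrite specE; apply: etrans (nroots_section_angle th k0K).
apply: (@locally_constant_on_connected R[i]^o V
  (fun k => nroots_disc (q k (omit j (torus_point a th))) (a j))) => //.
- exact: component_connected.
- by move=> x /VK; exact: nroots_section_near_k.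
- exact: connected_component_refl.
Qed.

(** The factor x_j ^ v has constant modulus a_j ^ v on the circle, which accounts for the subtracted
    term. *)
Lemma mean_ln_leval_section k (t : n.-tuple T) : ~ K k ->
  mean (fun s => ln (normc (leval (const_sub k P)
    (torus_point a (tnth (insert_coord j s t)))))) =
  - (v%:R * ln (a j)) + log_mean (q k (torus_point (omit j a) (tnth t))) (a j).
Proof.
move=> kK; rewrite -[X in X + _]mean_cst /log_mean -meanD.
- apply: mean_ext => s.
  rewrite -(omit_torus_point_insert j a s t).
  set x := torus_point a _.
  have xa : torus a x by exact: torus_torus_point.
  have -> : (a j)%:C * cis s = x j by rewrite /x /torus_point tnth_insert_coord.
  rewrite horner_section_const_sub -?normc_gt0 ?xa//.
  rewrite ComplexField.Normc.normcM normcX xa lnM ?posrE ?exprn_gt0//; last first.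
    by rewrite normc_gt0 leval_const_sub_neq0.
  by rewrite lnXn// mulr_natl addrC addrK.
- by move=> s; exact: cst_continuous.
- rewrite -(omit_torus_point_insert j a 0 t).
  apply: continuous_ln_horner_circle => // z.
  exact: section_root.
Qed.

End RootCountOnTorus.

Theorem theorem7p3 (R : realType) (n : nat) (hn : (2 <= n)%N)
    (a : 'I_n -> R) (ha : forall i, 0 < a i)
    (P : laurent R n) (hP : P 0 = 0) (k0 : R[i]) :
  let Pk k := const_sub k P in
  let K := [set leval P x | x in torus a] in
  let V := connected_component (~` K : set R[i]^o) k0 in
  ~ K k0 -> bounded_set V ->
  forall j : 'I_n,
  (size (specX j (Pk k0) a) = (vX j (Pk k0) + uX j (Pk k0)).+1 ->
   (forall z : R[i], root (specX j (Pk k0) a) z -> normc z < a j) ->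
   forall k, V k ->
     mahler a (leval (Pk k)) =
       (((nuX j (Pk k) a)%:~R * ln (a j))%:E
        + mahler (omit j a) (leval (leadX j (Pk k))))%E)
  /\
  ((forall z : R[i], root (specX j (Pk k0) a) z -> a j < normc z) ->
   forall k, V k ->
     mahler a (leval (Pk k)) =
       (((nuX j (Pk k) a)%:~R * ln (a j))%:E
        + mahler (omit j a) (leval (constX j (Pk k))))%E).
Proof.
case: n hn a ha P hP => [//|n] _ a a0 P _ Pk K V k0K _ j.
set v := vX j P; set d := (vX j P + uX j P)%N.
have vE k : vX j (Pk k) = v by exact: vX_const_sub.
have uE k : uX j (Pk k) = uX j P by exact: uX_const_sub.
have specE k : specX j (Pk k) a = section_poly j v d (Pk k) (omit j (fun i => (a i)%:C)).
  by rewrite specX_section_poly vE uE.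
have pt0 : torus_point a (fun=> 0) = (fun i => (a i)%:C).
  by apply/funext => i; rewrite /torus_point cis0 mulr1.
have spec_neq0 k : ~ K k -> specX j (Pk k) a != 0.
  by move=> kK; rewrite specE -pt0; exact: section_neq0.
have yE (t : n.-tuple (measurableTypeR R)) : torus_point (omit j a) (tnth t) =
    omit j (torus_point a (tnth (insert_coord j 0 t))).
  by rewrite omit_torus_point_insert.
split => [sz inside k Vk|outside k Vk].
(* Case (I): the size hypothesis gives exactly d roots with multiplicity, all inside the circle. *)
- have N0 : nroots_disc (specX j (Pk k0) a) (a j) = d.
    have -> : d = size (croots (specX j (Pk k0) a)).
      by apply: succn_inj; rewrite -size_croots ?spec_neq0// sz vE uE.
    apply/eqP; rewrite -all_count; apply/allP => z.
    by rewrite mem_croots ?spec_neq0//; exact: inside.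
  have kK := (nroots_section_const j a0 (fun=> 0) k0K Vk).1.
  have cnt th : nroots_disc (section_poly j v d (Pk k) (omit j (torus_point a th))) (a j) = d.
    exact: etrans (nroots_section_const j a0 th k0K Vk).2 N0.
  have nu : nuX j (Pk k) a = (uX j P)%:Z.
    by rewrite nuXE ?spec_neq0// specE -pt0 cnt vE /d PoszD addrAC subrr add0r.
  have lead (t : n.-tuple (measurableTypeR R)) := log_mean_roots_inside (a0 j)
    (section_neq0 j a0 (tnth (insert_coord j 0 t)) kK)
    (fun z => section_root a0 (k := k) (z := z) kK)
    (size_poly _ _) (cnt (tnth (insert_coord j 0 t))).
  have coefE y : (section_poly j v d (Pk k) y)`_d = leval (Defs.coefX j (uX j P)%:Z (Pk k)) y.
    by rewrite coef_poly ltnSn /d PoszD addrAC subrr add0r.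
  (* The top coefficient is nonzero on the whole torus; one point, here with all angles 0,
     identifies it as the leading one. *)
  have leadE : leadX j (Pk k) = Defs.coefX j (uX j P)%:Z (Pk k).
    rewrite -(uE k).
    apply: (@leadXE _ _ _ _ (omit j (torus_point a (tnth (insert_coord j 0 [tuple of nseq n 0]))))).
    by rewrite uE -coefE; exact: (lead _).1.
  apply: mahler_eliminate => // [x xa|t]; first exact: leval_const_sub_neq0 xa.
  (* The d roots give d ln a_j, and the factor x_j ^ v removes v ln a_j; d - v is [uX j P], the
     value of [nuX]. *)
  rewrite mean_ln_leval_section// yE (lead t).2 coefE leadE nu.
  by rewrite /d natrD -yE; ring.
- have kK := (nroots_section_const j a0 (fun=> 0) k0K Vk).1.
  have N0 : nroots_disc (specX j (Pk k0) a) (a j) = 0%N.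
    apply/eqP; rewrite -leqn0 leqNgt -has_count; apply/hasPn => z.
    by rewrite mem_croots ?spec_neq0// => /outside /ltW; rewrite leNgt.
  have cnt th : nroots_disc (section_poly j v d (Pk k) (omit j (torus_point a th))) (a j) = 0%N.
    exact: etrans (nroots_section_const j a0 th k0K Vk).2 N0.
  (* No root is inside the circle, so only the power x_j ^ v contributes. *)
  have nu : nuX j (Pk k) a = - v%:Z.
    by rewrite nuXE ?spec_neq0// specE -pt0 cnt vE sub0r.
  have const (t : n.-tuple (measurableTypeR R)) := log_mean_roots_outside (a0 j)
    (section_neq0 j a0 (tnth (insert_coord j 0 t)) kK)
    (fun z => section_root a0 (k := k) (z := z) kK)
    (cnt (tnth (insert_coord j 0 t))).
  apply: mahler_eliminate => // [x xa|t]; first exact: leval_const_sub_neq0 xa.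
  rewrite mean_ln_leval_section// yE (const t).2 coef_poly /= sub0r.
  by rewrite /constX vE nu -yE; congr (_ + _); rewrite mulrNz mulNr.
Qed.
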